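(* The group $\mathrm{Homeo}(M,\alpha)$ of strictly contact homeomorphisms with the contact topology is path-connected and locally path-connected. Any two strictly contact homeomorphisms can be connected inside $\mathrm{Homeo}(M,\alpha)$ by a topological strictly contact isotopy.
   Context: Setting. $M$ is a closed (compact, without boundary), connected smooth manifold of dimension $2n+1$ with a cooriented contact structure $\xi=\ker\alpha$, where $\alpha$ is a fixed contact form with Reeb vector field $R$, and $\nu_\alpha=\alpha\wedge(d\alpha)^n$. A smooth strictly contact isotopy is a smooth isotopy $\Phi=\{\phi_t\}_{0\le t\le1}$ with $\phi_0=\mathrm{id}$ and $\phi_t^*\alpha=\alpha$ for all $t$; if $\frac{d}{dt}\phi_t=X_t\circ\phi_t$, its Hamiltonian is $H_t=\alpha(X_t)$, and one writes $\Phi=\Phi_H=\{\phi_H^t\}$. The Hamiltonians so obtained are exactly the smooth basic functions $H\colon[0,1]\times M\to\mathbb R$ ($dH_t(R)=0$ for all $t$). Then $(\Phi_H,H)$ is a smooth strictly contact dynamical system. Norms and metrics. For a function $H$ on $M$, $\|H\|=\max_M H-\min_M H+\left|\frac{1}{\int_M\nu_\alpha}\int_M H\,\nu_\alpha\right|$; for $H\colon[0,1]\times M\to\mathbb R$, $\|H\|_{(1,\infty)}=\int_0^1\|H_t\|\,dt$. Fix a Riemannian distance $d$ on $M$; $\overline d(\phi,\psi)=\max_x d(\phi(x),\psi(x))+\max_x d(\phi^{-1}(x),\psi^{-1}(x))$ for homeomorphisms and $\overline d(\Phi,\Psi)=\max_t\overline d(\phi_t,\psi_t)$ for isotopies. A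 pair $(\Phi,H)$ of a continuous isotopy of homeomorphisms and a function $H\colon[0,1]\times M\to\mathbb R$ is a topological strictly contact dynamical system if there are smooth strictly contact dynamical systems $(\Phi_{H_i},H_i)$ with $\Phi_{H_i}\to\Phi$ uniformly and $\|H-H_i\|_{(1,\infty)}\to0$ ($H\in L^1([0,1],C^0(M))$); then $\Phi=\Phi_H$ is a topological strictly contact isotopy (based at the identity). The set of these pairs is $\mathcal{TSCDS}(M,\alpha)$, with metric $d_\alpha((\Phi_H,H),(\Phi_F,F))=\overline d(\Phi_H,\Phi_F)+\|H-F\|_{(1,\infty)}$. $\mathrm{Homeo}(M,\alpha)$ is the group (under composition) of time-one maps $\phi_H^1$ of topological strictly contact dynamical systems, and its contact topology is the quotient topology induced by the surjection $\mathrm{ev}_1\colon\mathcal{TSCDS}(M,\alpha)\to\mathrm{Homeo}(M,\alpha)$, $(\Phi_H,H)\mapsto\phi_H^1$. A topological strictly contact isotopy whose time-zero map is not necessarily the identity is an isotopy of the form $\psi\circ\Phi_H=\{\psi\circ\phi_H^t\}$, with $\Phi_H$ a topological strictly contact isotopy based at the identity and $\psi$ a topological automorphism of $\alpha$, i.e. a homeomorphism that is a uniform limit of diffeomorphisms $\psi_i$ with $\psi_i^*\alpha=e^{g_i}\alpha$, $g_i$ smooth and $g_i\to0$ uniformly. (One could equally work with isotopies $\Phi_H\circ\psi$.) *)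

(* Defs.v *)
From HB Require Import structures.
From mathcomp Require Import all_boot all_order all_fingroup all_algebra.
From mathcomp Require Import all_classical all_reals all_analysis.

Set Implicit Arguments.
Unset Strict Implicit.
Unset Printing Implicit Defensive.

Import Order.TTheory GRing.Theory Num.Theory.
Import numFieldNormedType.Exports.

Local Open Scope classical_set_scope.
Local Open Scope ring_scope.

(* The library's sigma-algebras live on pointed types, whence the pointed
   variant of metricType; the base point plays no role beyond nonemptiness. *)
#[short(type="pointedMetricType")]
HB.structure Definition PointedMetric (R : numDomainType) :=
  {M of Pointed M & Metric R M}.

Section smoothness.
Context {R : realType}.

Fixpoint Ck (V W : normedModType R) (k : nat) (U : set V) (f : V -> W) : Prop :=
  (forall x, U x -> {for x, continuous f}) /\
  if k is k'.+1 then
    forall v, (forall x, U x -> derivable f x v) /\ Ck k' U ('D_v f)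
  else True.

(* Smoothness on an arbitrary set A: local extendability to C^infty functions
   on open sets. For open A this is the usual notion; it is also applied to
   sets such as [0, 1] * U. *)
Definition smooth_on (V W : normedModType R) (A : set V) (f : V -> W) : Prop :=
  forall x, A x -> exists (O : set V) (g : V -> W),
    [/\ open O, O x, forall k, Ck k O g & forall y, A y -> O y -> g y = f y].

End smoothness.

Section manifolds.
Context {R : realType}.

(* A chart is total on both sides; only cfun on cdom and cinv on ccod matter. *)
Record chart (M : topologicalType) (m : nat) := Chart {
  cdom : set M;
  ccod : set 'rV[R]_m;
  cfun : M -> 'rV[R]_m;
  cinv : 'rV[R]_m -> M;
  chart_open_dom : open cdom;
  chart_open_cod : open ccod;
  chart_fun_cod : forall x, cdom x -> ccod (cfun x);
  chart_inv_dom : forall y, ccod y -> cdom (cinv y);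
  chart_funK : forall x, cdom x -> cinv (cfun x) = x;
  chart_invK : forall y, ccod y -> cfun (cinv y) = y;
  chart_fun_continuous : forall x, cdom x -> {for x, continuous cfun};
  chart_inv_continuous : forall y, ccod y -> {for y, continuous cinv}
}.

Definition smooth_transition (M : topologicalType) m (c c' : chart M m) :=
  smooth_on (ccod c `&` cinv c @^-1` cdom c') (cfun c' \o cinv c).

(* A maximal smooth atlas. *)
Record smooth_structure (M : topologicalType) (m : nat) := SmoothStructure {
  atlas : set (chart M m);
  atlas_cover : forall x, exists2 c, atlas c & cdom c x;
  atlas_compatible : forall c c', atlas c -> atlas c' -> smooth_transition c c';
  atlas_maximal : forall c, (forall c', atlas c' ->
    smooth_transition c c' /\ smooth_transition c' c) -> atlas c
}.

Section smooth_objects.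
Context {M : topologicalType} {m : nat} (S : smooth_structure M m).

Definition smooth_function (f : M -> R) :=
  forall c, atlas S c -> smooth_on (ccod c) (f \o cinv c : _ -> R^o).

Definition smooth_map (f : M -> M) :=
  continuous f /\
  forall c c', atlas S c -> atlas S c' ->
    smooth_on (ccod c `&` (f \o cinv c) @^-1` cdom c') (cfun c' \o f \o cinv c).

Definition continuous_family (F : R -> M -> M) :=
  {within `[0, 1] `*` [set: M], continuous (fun p : R * M => F p.1 p.2)}.

(* Smoothness of (t, x) |-> F t x as a map [0, 1] * M -> M. *)
Definition smooth_family (F : R -> M -> M) :=
  continuous_family F /\
  forall c c', atlas S c -> atlas S c' ->
    smooth_on [set p : R^o * 'rV[R]_m | [/\ p.1 \in `[0, 1], ccod c p.2 &
                                           cdom c' (F p.1 (cinv c p.2))]]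
              (fun p => cfun c' (F p.1 (cinv c p.2))).

(* A differential 1-form is given by its coefficient rows in all charts. *)
Definition form_coefs := chart M m -> 'rV[R]_m -> 'rV[R]_m.

Definition pairing (a v : 'rV[R]_m) : R := \sum_i a 0 i * v 0 i.

(* f^* alpha = h alpha, read in charts at every point. *)
Definition pulls_back (alpha : form_coefs) (f : M -> M) (h : M -> R) :=
  forall c c' x v, atlas S c -> atlas S c' -> cdom c x -> cdom c' (f x) ->
    pairing (alpha c' (cfun c' (f x)))
            ('D_v (cfun c' \o f \o cinv c) (cfun c x)) =
    h x * pairing (alpha c (cfun c x)) v.

(* With f = id, pulls_back is the law of change of charts. *)
Definition is_one_form (alpha : form_coefs) :=
  (forall c, atlas S c -> smooth_on (ccod c) (alpha c)) /\
  pulls_back alpha id (cst 1).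

(* (d alpha)(e_i, e_j) *)
Definition dform (alpha : form_coefs) (c : chart M m) (y : 'rV[R]_m)
    (i j : 'I_m) : R :=
  'D_(delta_mx 0 i) (fun z => alpha c z 0 j : R^o) y -
  'D_(delta_mx 0 j) (fun z => alpha c z 0 i : R^o) y.

Definition metric_coefs := chart M m -> 'rV[R]_m -> 'M[R]_m.

Definition quadratic (g : 'M[R]_m) (v : 'rV[R]_m) : R :=
  (v *m g *m v^T) 0 0.

Definition is_riemannian_metric (g : metric_coefs) :=
  [/\ forall c, atlas S c -> smooth_on (ccod c) (g c),
      forall c y, atlas S c -> ccod c y -> (g c y)^T = g c y,
      forall c y v, atlas S c -> ccod c y -> v != 0 -> 0 < quadratic (g c y) v &
      forall c c' x v, atlas S c -> atlas S c' -> cdom c x -> cdom c' x ->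
        quadratic (g c' (cfun c' x)) ('D_v (cfun c' \o cinv c) (cfun c x)) =
        quadratic (g c (cfun c x)) v].

Definition smooth_curve_on (a b : R) (gamma : R -> M) :=
  forall c, atlas S c ->
    smooth_on (`[a, b] `&` gamma @^-1` cdom c : set R^o) (cfun c \o gamma).

Definition piecewise_smooth_curve (gamma : R -> M) :=
  {within `[0, 1], continuous gamma} /\
  exists ts : seq R, let bs := 0 :: rcons ts 1 in
    sorted <%R bs /\
    forall i, (i <= size ts)%N -> smooth_curve_on bs`_i bs`_i.+1 gamma.

(* s is the speed |gamma'| wherever gamma is differentiable, that is, for a
   piecewise smooth gamma, at all but finitely many t. *)
Definition is_speed (g : metric_coefs) (gamma : R -> M) (s : R -> R) :=
  forall c (t : R), atlas S c -> 0 < t < 1 -> cdom c (gamma t) ->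
    derivable (cfun c \o gamma : R^o -> _) t 1 ->
    s t = Num.sqrt (quadratic (g c (cfun c (gamma t)))
                              (derive1 (cfun c \o gamma) t)).

Definition curve_lengths (g : metric_coefs) (x y : M) : set (\bar R) :=
  [set l | exists (gamma : R -> M) (s : R -> R),
    [/\ piecewise_smooth_curve gamma, gamma 0 = x, gamma 1 = y,
        is_speed g gamma s &
        l = (\int[lebesgue_measure]_(t in `[0%R, 1%R]) (s t)%:E)%E]].

End smooth_objects.

Definition is_riemannian_distance (M : metricType R) m
    (S : smooth_structure M m) (g : metric_coefs) :=
  forall x y : M, (mdist x y)%:E = ereal_inf (curve_lengths S g x y).

End manifolds.
Arguments chart : clear implicits.
Arguments smooth_structure : clear implicits.
Arguments form_coefs : clear implicits.
Arguments metric_coefs : clear implicits.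

Section homeomorphisms.

Record homeo (M : topologicalType) := Homeo {
  hfun :> M -> M;
  hinv : M -> M;
  hfun_continuous : continuous hfun;
  hinv_continuous : continuous hinv;
  hfunK : cancel hfun hinv;
  hinvK : cancel hinv hfun
}.

Context {M : topologicalType}.

Lemma comp_homeo_continuous (f g : M -> M) :
  continuous f -> continuous g -> continuous (f \o g).
Proof. by move=> cf cg x; apply: continuous_comp; [exact: cg|exact: cf]. Qed.

Definition comp_homeo (f g : homeo M) : homeo M :=
  Homeo (comp_homeo_continuous (@hfun_continuous _ f) (@hfun_continuous _ g))
        (comp_homeo_continuous (@hinv_continuous _ g) (@hinv_continuous _ f))
        (can_comp (@hfunK _ f) (@hfunK _ g))
        (can_comp (@hinvK _ g) (@hinvK _ f)).

End homeomorphisms.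

Section distances.
Context {R : realType} {M : metricType R}.

(* All suprema below are maxima in the intended use: M is compact and the
   functions are continuous. *)
Definition dbar (phi psi : homeo M) : R :=
  sup (range (fun x => mdist (phi x) (psi x))) +
  sup (range (fun x => mdist (hinv phi x) (hinv psi x))).

Definition dbar_iso (Phi Psi : R -> homeo M) : R :=
  sup [set dbar (Phi t) (Psi t) | t in `[0, 1]].

End distances.

Section volume.
Context {R : realType}.

(* Lebesgue integral over R^m of a nonnegative Borel function, as an iterated
   integral. *)
Fixpoint lebesgue_integral_rV (m : nat) : ('rV[R]_m -> \bar R) -> \bar R :=
  match m return ('rV[R]_m -> \bar R) -> \bar R with
  | 0 => fun f => f 0
  | k.+1 => fun f =>
      (\int[lebesgue_measure]_t
         lebesgue_integral_rV (fun v : 'rV[R]_k => f (row_mx t%:M v)))%E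
  end.

Section contact_volume.
Context {M : topologicalType} {n : nat}.

(* The coefficient of alpha /\ (d alpha)^n on dx_0 /\ ... /\ dx_2n, obtained by
   expanding alpha = \sum_i a_i dx_i and
   d alpha = 1/2 \sum_(i, j) (d alpha)(e_i, e_j) dx_i /\ dx_j. *)
Definition volume_coef (alpha : form_coefs R M n.*2.+1)
    (c : chart R M n.*2.+1) (y : 'rV[R]_n.*2.+1) : R :=
  2 ^- n * \sum_(s : 'S_(n.*2.+1)) (-1) ^+ odd_perm s *
    (alpha c y 0 (s ord0) *
     \prod_(k < n) dform alpha c y (s (inord k.*2.+1)) (s (inord k.*2.+2))).

Definition is_contact_form (S : smooth_structure R M n.*2.+1)
    (alpha : form_coefs R M n.*2.+1) :=
  is_one_form S alpha /\
  forall c y, atlas S c -> ccod c y -> volume_coef alpha c y != 0.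

End contact_volume.

(* mu is the Borel measure on M of the volume form alpha /\ (d alpha)^n, M being
   oriented by this form. As M is covered by finitely many charts when it is
   compact, these conditions determine mu. *)
Definition is_contact_volume (M : pointedMetricType R) (n : nat)
    (S : smooth_structure R M n.*2.+1) (alpha : form_coefs R M n.*2.+1)
    (mu : {measure set (g_sigma_algebraType (@open M)) -> \bar R}) :=
  forall c (A : set (g_sigma_algebraType (@open M))),
    atlas S c -> measurable A -> A `<=` cdom c ->
    mu A = lebesgue_integral_rV (fun y =>
      (\1_(ccod c `&` cinv c @^-1` A) y * `|volume_coef alpha c y|)%:E).

End volume.

Section contact_dynamics.
Context {R : realType} {M : pointedMetricType R} {n : nat}.
Context (S : smooth_structure R M n.*2.+1) (alpha : form_coefs R M n.*2.+1).
Context (mu : {measure set (g_sigma_algebraType (@open M)) -> \bar R}).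

Definition hnorm (f : M -> R) : R :=
  sup (range f) - inf (range f) +
  `| (fine (mu [set: M]))^-1 * fine (\int[mu]_x (f x)%:E)%E |.

Definition hnorm1 (H : R -> M -> R) : \bar R :=
  (\int[lebesgue_measure]_(t in `[0%R, 1%R]) (hnorm (H t))%:E)%E.

Definition sub_ham (H F : R -> M -> R) : R -> M -> R := fun t x => H t x - F t x.

(* Bochner integrability of H : [0, 1] -> C^0(M), for a representative of its
   class that is the pointwise limit, in the uniform norm, of simple functions
   s k : [0, 1] -> C^0(M). *)
Definition L1C0 (H : R -> M -> R) :=
  [/\ forall t, t \in `[0, 1] -> continuous (H t),
      exists s : nat -> R -> M -> R,
        [/\ forall k, finite_set (s k @` `[0, 1]),
            forall k f, measurable (`[0, 1] `&` s k @^-1` [set f]),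
            forall k t, t \in `[0, 1] -> continuous (s k t) &
            forall t, t \in `[0, 1] -> {uniform, (s ^~ t) @ \oo --> H t}] &
      (hnorm1 H < +oo)%E].

(* The velocity at time t, in [0, 1], of the path s |-> Phi s x, in the chart
   c; it is one-sided if t = 0 or t = 1. *)
Definition is_velocity (Phi : R -> homeo M) (t : R) (x : M)
    (c : chart R M n.*2.+1) (v : 'rV[R]_n.*2.+1) :=
  (fun h : R => h^-1 *: (cfun c (Phi (t + h) x) - cfun c (Phi t x)))
    @ within [set h | t + h \in `[0, 1]] 0^' --> v.

Definition smooth_isotopy (Phi : R -> homeo M) :=
  [/\ smooth_family S (fun t => Phi t), smooth_family S (fun t => hinv (Phi t)) &
      forall x, Phi 0 x = x].

Definition smooth_strictly_contact_isotopy (Phi : R -> homeo M) :=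
  smooth_isotopy Phi /\
  forall t, t \in `[0, 1] -> pulls_back S alpha (Phi t) (cst 1).

(* H_t = alpha(X_t), where d/dt phi_t = X_t \o phi_t. *)
Definition generates (Phi : R -> homeo M) (H : R -> M -> R) :=
  forall t x c, t \in `[0, 1] -> atlas S c -> cdom c (Phi t x) ->
    exists2 v, is_velocity Phi t x c v &
      H t (Phi t x) = pairing (alpha c (cfun c (Phi t x))) v.

Definition smooth_scds (Phi : R -> homeo M) (H : R -> M -> R) :=
  smooth_strictly_contact_isotopy Phi /\ generates Phi H.

Definition is_tscds (Phi : R -> homeo M) (H : R -> M -> R) :=
  [/\ continuous_family (fun t => Phi t),
      L1C0 H &
      exists (Phi_ : nat -> R -> homeo M) (H_ : nat -> R -> M -> R),
        [/\ forall i, smooth_scds (Phi_ i) (H_ i),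
            (fun i => dbar_iso (Phi_ i) Phi) @ \oo --> (0 : R) &
            (fun i => hnorm1 (sub_ham H (H_ i))) @ \oo --> 0%E]].

(* Isotopies and Hamiltonians are functions on R of which only the restriction
   to [0, 1] is considered, and Hamiltonians are representatives of elements of
   L^1([0, 1], C^0(M)): d_alpha does not separate two representations of the
   same system, which have the same time-one map. *)
Record tscds := Tscds {
  iso : R -> homeo M;
  ham : R -> M -> R;
  tscdsP : is_tscds iso ham
}.

HB.instance Definition _ := gen_eqMixin tscds.
HB.instance Definition _ := gen_choiceMixin tscds.

Definition d_alpha (p q : tscds) : \bar R :=
  ((dbar_iso (iso p) (iso q))%:E + hnorm1 (sub_ham (ham p) (ham q)))%E.

Definition tscds_open (U : set tscds) :=
  forall p, U p -> exists2 e : R, 0 < e & forall q, (d_alpha p q < e%:E)%E -> U q.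

Lemma tscds_openT : tscds_open setT.
Proof. by move=> p _; exists 1. Qed.

Lemma tscds_openI : setI_closed tscds_open.
Proof.
move=> U V oU oV p [/oU[e e0 eU] /oV[d d0 dV]].
exists (Num.min e d); first by rewrite lt_min e0.
move=> q; rewrite EFin_min => pq; split.
- by apply: eU; apply: (lt_le_trans pq); rewrite ge_min lexx.
- by apply: dV; apply: (lt_le_trans pq); rewrite ge_min lexx orbT.
Qed.

Lemma tscds_open_bigU (I : Type) (f : I -> set tscds) :
  (forall i, tscds_open (f i)) -> tscds_open (\bigcup_i f i).
Proof.
move=> of_ p [i _ /of_[e e0 ef]]; exists e => // q /ef fq; by exists i.
Qed.

HB.instance Definition _ :=
  isOpenTopological.Build tscds tscds_openT tscds_openI tscds_open_bigU.

(* Homeo(M, alpha) *)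
Record homeo_alpha := HomeoAlpha {
  ha_val :> homeo M;
  ha_valP : exists p : tscds, iso p 1 = ha_val
}.

Definition ev1 (p : tscds) : homeo_alpha :=
  HomeoAlpha (ex_intro (fun q : tscds => iso q 1 = iso p 1) p erefl).

HB.instance Definition _ := gen_eqMixin homeo_alpha.
HB.instance Definition _ := gen_choiceMixin homeo_alpha.

(* The contact topology: the quotient topology of ev1. *)
Definition contact_open (U : set homeo_alpha) := open (ev1 @^-1` U).

Lemma contact_openT : contact_open setT.
Proof. by rewrite /contact_open preimage_setT; exact: openT. Qed.

Lemma contact_openI : setI_closed contact_open.
Proof. by move=> U V; exact: openI. Qed.

Lemma contact_open_bigU (I : Type) (f : I -> set homeo_alpha) :
  (forall i, contact_open (f i)) -> contact_open (\bigcup_i f i).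
Proof. by move=> of_; apply: bigcup_open => i _; exact: of_. Qed.

HB.instance Definition _ := isOpenTopological.Build homeo_alpha
  contact_openT contact_openI contact_open_bigU.

Definition is_topological_automorphism (psi : homeo M) :=
  exists (psi_ : nat -> homeo M) (g_ : nat -> M -> R),
    [/\ forall i, smooth_map S (psi_ i) /\ smooth_map S (hinv (psi_ i)),
        forall i, smooth_function S (g_ i),
        forall i, pulls_back S alpha (psi_ i) (fun x => expR (g_ i x)),
        (fun i => dbar (psi_ i) psi) @ \oo --> (0 : R) &
        {uniform, g_ @ \oo --> cst 0}].

(* The time-zero map is not necessarily the identity. *)
Definition is_topological_isotopy (Psi : R -> homeo M) :=
  exists (psi : homeo M) (p : tscds), is_topological_automorphism psi /\
    forall t, t \in `[0, 1] -> Psi t = comp_homeo psi (iso p t).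

End contact_dynamics.

Section path_connectedness.
Context (R : realType) {T : topologicalType}.

Definition path_from_to (gamma : R -> T) (x y : T) :=
  [/\ {within `[0, 1], continuous gamma}, gamma 0 = x & gamma 1 = y].

Definition path_connected (A : set T) :=
  forall x y, A x -> A y ->
    exists2 gamma : R -> T, path_from_to gamma x y & gamma @` `[0, 1] `<=` A.

Definition locally_path_connected :=
  forall (x : T) (U : set T), open U -> U x ->
    exists V : set T, [/\ open V, V x, V `<=` U & path_connected V].

End path_connectedness.
Arguments locally_path_connected : clear implicits.

(* Main.v *)
(* A system (Phi, H) can be run at speed s: (phi_{st}, s H_{st}) is again a
   system, s |-> (phi_{st}, s H_{st}) is continuous for d_alpha, and its time-one
   maps trace out the isotopy Phi. Systems form a group with left division
   (Phi, H) \ (Psi, F) = (phi_t^-1 psi_t, (F_t - H_t) o phi_t), so that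
   s |-> p * (p \ q run at speed s) is a path from p to q, and it stays close to
   p when q is close to p. Its time-one maps are phi_1 o chi_s with Chi the isotopy
   of p \ q; this gives path-connectedness and the connecting isotopy. For local
   path-connectedness, the path component of a point in an open set U of the
   quotient topology is open, because its preimage contains with p all q close to p.
   Composition is continuous for d_alpha without appeal to the volume-preserving
   property of strictly contact maps, because hnorm (f o phi) <= 2 hnorm f for
   every homeomorphism phi. *)

Require Import Defs.
From HB Require Import structures.
From mathcomp Require Import all_boot all_order all_fingroup all_algebra.
From mathcomp Require Import all_classical all_reals all_analysis.
From mathcomp Require Import measurable_realfun ring lra.

Set Implicit Arguments.
Unset Strict Implicit.
Unset Printing Implicit Defensive.

Import Order.TTheory GRing.Theory Num.Theory.
Import numFieldNormedType.Exports.

Local Open Scope classical_set_scope.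
Local Open Scope ring_scope.

(** Two gaps separate topological systems from calculus. Their isotopies cannot be differentiated,
    so the law for left division is derived for smooth systems and passed to limits. Their
    Hamiltonians are merely integrable in time, so [H] itself has no modulus of continuity with
    which to compare [H t (phi t x)] and [H t (psi t x)]. The remedy is a uniformly continuous [K]
    close to [H] in [hnorm1]: the difference [H - K] is paid for by the bound on composition, and
    [K] by its modulus. The smooth approximants of the system serve as [K]. Left division is the
    only binary operation taken to the limit; the identity is a system run at speed 0, and products
    and inverses are built from these two. On the smooth side, [Ck] speaks of iterated directional
    derivatives, whereas the chain rule rests on Frechet differentiability; the first sections
    supply it on open sets of time and one chart, where families extend beyond the closed interval
    of times. *)

Section C1_differentiable.

(** * Continuous directional derivatives give Frechet differentiability *)

Context {R : realType}.

(** One-variable mean value theorem on the segment from [y] to [h *: e + y], oriented by the sign of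
    [h]. It controls a single step of the path used in [C1_increment]. *)
Lemma mean_value_line (V : normedModType R) (f : V -> R^o) (y e : V)
    (h L eps : R) :
  (forall t : R, `|t| <= `|h| -> derivable f (t *: e + y) e /\
     `|'D_e f (t *: e + y) - L| <= eps) ->
  `|f (h *: e + y) - f y - h * L| <= eps * `|h|.
Proof.
move=> Hf; pose k (t : R) : R := f (t *: e + y).
have kder t : `|t| <= `|h| -> is_derive (t : R^o) (1 : R^o) (k : R^o ->
  R^o) ('D_e f (t *: e + y)).
  move=> /Hf[fd _].
  have E : (fun s : R => s^-1 *: ((k \o shift t) (s *: (1 : R^o)) - k t)) =
      (fun s : R => s^-1 *: ((f \o shift (t *: e + y)) (s *: e) - f (t *: e + y))).
    apply/funext => s; rewrite /k /=; congr (_ *: (f _ - _)).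
    by rewrite [s *: (1 : R^o)]mulr1 scalerDl addrA.
  by split; rewrite /derivable /derive E.
have kc : forall t, `|t| <= `|h| -> {for t, continuous k}.
  move=> t /kder [kd _]; apply: differentiable_continuous.
  exact/derivable1_diffP.
have main a b : a <= b -> (forall t, t \in `[a, b]%R -> `|t| <= `|h|) ->
    `|k b - k a - (b - a) * L| <= eps * (b - a).
  move=> ab abh.
  have [|t tab|c cab ->] := @MVT_segment R k (fun t => 'D_e f (t *: e + y)) a b ab.
  - by move=> t tab; apply: kder; apply: abh; rewrite in_itv /= !ltW ?(itvP tab).
  - apply: continuous_in_subspaceT => s /set_mem /= sab.
    by apply: kc; exact: abh.
  - rewrite mulrC -mulrBr normrM [`|b - a|]ger0_norm ?subr_ge0// mulrC.
    by apply: ler_wpM2r; [rewrite subr_ge0|exact: (Hf _ (abh _ cab)).2].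
have k0 : k 0 = f y by rewrite /k scale0r add0r.
rewrite -/(k h) -k0; case: (leP 0 h) => h0.
- have := main 0 h h0; rewrite subr0 ger0_norm//; apply.
  by move=> t; rewrite in_itv/= => /andP[t0 th]; rewrite ger0_norm// ger0_norm//.
- have := main h 0 (ltW h0); rewrite sub0r (ltr0_norm h0).
  rewrite -normrN => H; apply: le_trans (H _) => //.
  + by rewrite le_eqVlt; apply/orP; left; apply/eqP; congr `|_|; ring.
  + by move=> t; rewrite in_itv/= => /andP[t0 th]; rewrite ler0_norm// lerN2.
Qed.

Lemma differentiable_eps (V Z : normedModType R) (f : V -> Z)
    (df : {linear V -> Z}) (x : V) :
  continuous df ->
  (forall eps : R, 0 < eps -> exists2 d : R, 0 < d & forall w, `|w| < d ->
     `|f (w + x) - f x - df w| <= eps * `|w|) ->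
  differentiable f x /\ 'd f x = df :> (V -> Z).
Proof.
move=> dfc H.
have E : f \o shift x = cst (f x) + df +o_ 0 id.
  apply/eqaddoP => eps eps0; have [d d0 Hd] := H eps eps0.
  near=> w; have wd : `|w| < d by near: w; exact: nbhs0_lt.
  by have := Hd w wd; rewrite -addrA -opprD.
have dE := diff_unique dfc E.
by split => //; apply/diff_locallyP; rewrite dE.
Unshelve. all: by end_near. Qed.

(** The increment is split into moves along one [e i] at a time. Each move differs from its linear
    part by at most [eps * |h i|], because the intermediate points stay in a ball around [x] where
    ['D_(e i) f] is within [eps] of its value at [x]. *)
Lemma C1_increment (V : normedModType R) (I : eqType) (e : I -> V)
    (f : V -> R^o) (U : set V) (x : V) (s : seq I) :
  open U -> U x ->
  (forall i y, U y -> derivable f y (e i)) ->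
  (forall i, {for x, continuous ('D_(e i) f)}) ->
  forall eps : R, 0 < eps -> exists2 d : R, 0 < d &
    forall y (h : I -> R), `|y - x| < d -> (forall i, `|h i| < d) ->
      `|f (\sum_(i <- s) h i *: e i + y) - f y - \sum_(i <- s) h i * 'D_(e i) f x|
      <= eps * \sum_(i <- s) `|h i|.
Proof.
move=> oU Ux fd fc eps eps0; elim: s => [|i s [d d0 IH]].
  exists 1 => // y h _ _.
  by rewrite !big_nil add0r subrr subr0 normr0 mulr0.
have [r r0 Hr] : exists2 r : R, 0 < r & forall y, `|y - x| < r ->
    U y /\ `|'D_(e i) f y - 'D_(e i) f x| <= eps.
  have : \forall y \near x, U y /\ `|'D_(e i) f y - 'D_(e i) f x| <= eps.
    apply: filterI; first exact: open_nbhs_nbhs.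
    have /cvgrPdist_le /(_ _ eps0) := fc i.
    by apply: filterS => y; rewrite distrC.
  move=> /nbhs_ballP [r /= r0 H]; exists r => // y yx.
  by apply: H; rewrite -ball_normE /= distrC.
(* With [|y - x|] and every [|h j|] below [r / C], an intermediate point is at distance less than
   [(r / C) * (C - 1) + r / C = r] from [x]; the summand 1 accounts for [|y - x|]. *)
pose C := 1 + \sum_(j <- i :: s) `|e j|.
have CE : C - 1 = \sum_(j <- i :: s) `|e j| by rewrite /C addrAC subrr add0r.
have C1 : 1 <= C by rewrite lerDl sumr_ge0.
have C0 : 0 < C by exact: lt_le_trans C1.
exists (Num.min d (r / C)) => [|y h]; first by rewrite lt_min d0 divr_gt0.
rewrite lt_min => /andP[yxd yxr] hh.
have hd j : `|h j| < d by have := hh j; rewrite lt_min => /andP[].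
have hr j : `|h j| < r / C by have := hh j; rewrite lt_min => /andP[].
rewrite !big_cons; set z := \sum_(j <- s) h j *: e j + y.
have := IH y h yxd hd; rewrite -/z => Hs.
have Hi : `|f (h i *: e i + z) - f z - h i * 'D_(e i) f x| <= eps * `|h i|.
  apply: mean_value_line => t th.
  have : `|t *: e i + z - x| < r.
    have -> : t *: e i + z - x = (t *: e i + \sum_(j <- s) h j *: e j) + (y - x).
      by rewrite /z !addrA.
    rewrite (le_lt_trans (ler_normD _ _))//.
    have -> : r = (r / C) * (C - 1) + r / C.
      by rewrite mulrBr mulr1 subrK divfK//; exact: lt0r_neq0.
    apply: ler_ltD => //.
    rewrite (le_trans (ler_normD _ _))// CE big_cons mulrDr.
    apply: lerD.
      by rewrite normrZ ler_wpM2r// (le_trans th)// ltW// hr.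
    rewrite (le_trans (ler_norm_sum _ _ _))// mulr_sumr ler_sum// => j _.
    by rewrite normrZ ler_wpM2r// ltW// hr.
  by move=> /Hr[Uz ?]; split => //; exact: fd.
have -> : h i *: e i + \sum_(j <- s) h j *: e j + y = h i *: e i + z.
  by rewrite /z addrA.
rewrite mulrDr; apply: le_trans (lerD Hi Hs).
apply: le_trans (ler_normD _ _).
rewrite le_eqVlt; apply/orP; left; apply/eqP; congr `|_|.
have E (a b c p q : R) : a - c - (p + q) = a - b - p + (b - c - q) by ring.
exact: E.
Qed.

Local Notation W m := (R^o * 'rV[R]_m)%type.

Definition direction m (i : option 'I_m) : W m :=
  if i is Some j then (0, delta_mx 0 j) else (1, 0).

Definition coordinate m (w : W m) (i : option 'I_m) : R :=
  if i is Some j then w.2 0 j else w.1.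

Definition directions m : seq (option 'I_m) := None :: map Some (enum 'I_m).

Lemma big_directions (V : nmodType) m (F : option 'I_m -> V) :
  \sum_(i <- directions m) F i = F None + \sum_i F (Some i).
Proof. by rewrite big_cons big_map big_enum. Qed.

Lemma direction_sum m (w : W m) : w = \sum_(i <- directions m) coordinate w i *:
  direction i.
Proof.
rewrite big_directions /=; case: w => t v /=.
have -> : \sum_(i < m) v 0 i *: ((0, delta_mx 0 i) : W m) = (0, v).
  rewrite [in RHS](row_sum_delta v).
  elim/big_ind2: _ => // [a b c d -> ->|i _]; first by congr (_, _); rewrite ?addr0.
  by congr (_, _); rewrite /= scaler0.
have -> : t *: ((1, 0) : W m) = (t, 0).
  by congr (_, _); rewrite /= ?scaler0//; exact: mulr1.
by congr (_, _); rewrite /= ?addr0 ?add0r.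
Qed.

Lemma norm_coordinate_le m (w : W m) i : `|coordinate w i| <= `|w|.
Proof.
rewrite prod_normE /= le_max; case: i => [i|] /=; last by rewrite lexx.
apply/orP; right; rewrite [leRHS]/Num.Def.normr/= mx_normrE.
exact: (le_bigmax _ _ (0, i)).
Qed.

Lemma coordinate_continuous m i : continuous (fun w : W m => coordinate w i : R).
Proof.
case: i => [i|] w /=; last exact: cvg_fst.
apply: (@continuous_comp _ _ _ (@snd R^o 'rV[R]_m) (fun v : 'rV[R]_m => v 0 i)).
  exact: cvg_snd.
exact: coord_continuous.
Qed.

Section C1.
Variables (m : nat) (c : option 'I_m -> R).
(** The candidate for the differential, once [c] holds the derivatives along the basis; it is made a
    canonical linear map so that [differentiable_eps] applies. *)
Definition coordinate_form (w : W m) : R^o := \sum_(i <- directions m) coordinate w i *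
  c i.

Let coordinate_form_linear : linear coordinate_form.
Proof.
move=> k u v; rewrite /coordinate_form scaler_sumr -big_split /=.
apply: eq_bigr => i _;
  rewrite -[X in _ = X + _]/(k * (coordinate u i * c i)) mulrA -mulrDl; congr (_ * _).
by case: i => [i|] //=; rewrite !mxE.
Qed.

HB.instance Definition _ :=
  GRing.isLinear.Build _ _ _ _ coordinate_form coordinate_form_linear.

Lemma coordinate_form_continuous : continuous coordinate_form.
Proof.
move=> w; rewrite /coordinate_form /directions; elim: (None :: _) => [|i s IH].
  by under eq_fun do rewrite big_nil; exact: cvg_cst.
under eq_fun do rewrite big_cons.
apply: (@continuousD _ _ _ (fun w => coordinate w i * c i)) => //.
apply: continuousM; [exact: coordinate_continuous|exact: cst_continuous].
Qed.
End C1.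

(** [C1_increment] along the basis, started at [x], bounds the error by the sum of the absolute
    coordinates of [w], each at most [|w|]; hence the division of [eps] by the number of
    directions. *)
Lemma C1_differentiable m (f : W m -> R^o) (U : set (W m)) x :
  open U -> U x ->
  (forall v y, U y -> derivable f y v) ->
  (forall v, {for x, continuous ('D_v f)}) ->
  differentiable f x /\
  forall v, 'D_v f x = \sum_(i <- directions m) coordinate v i * 'D_(direction i) f x.
Proof.
move=> oU Ux fd fc.
pose df : {linear W m -> R^o} := coordinate_form (fun i => 'D_(direction i) f x).
have dfc : continuous df by exact: coordinate_form_continuous.
have [fdiff dE] : differentiable f x /\ ('d f x = df :> (_ -> _)).
  apply: differentiable_eps => // eps eps0.
  have N0 : 0 < (size (directions m))%:R :> R by rewrite ltr0n.
  have [d d0 Hd] := @C1_increment _ _ (@direction m) f U x (directions m) oU Ux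
     (fun i y => @fd (direction i) y) (fun i => @fc (direction i)) _ (divr_gt0 eps0 N0).
  exists d => // w wd.
  have := Hd x (coordinate w); rewrite -direction_sum subrr normr0 => /(_ d0).
  have H i : `|coordinate w i| < d by rewrite (le_lt_trans (norm_coordinate_le _ _)).
  move=> /(_ H) /le_trans; apply.
  rewrite -mulrA ler_pM2l// ler_pdivrMl// mulrC mulr_natr.
  rewrite -(count_predT (directions m)) -iter_addr_0 -big_const_seq.
  by rewrite ler_sum// => i _; exact: norm_coordinate_le.
by split => // v; rewrite deriveE// dE.
Qed.

End C1_differentiable.

(** * Calculus of C^k maps, up to the chain rule *)

Section Ck_theory.
Context {R : realType}.
Local Notation W m := (R^o * 'rV[R]_m)%type.

Lemma derive_line (V Z : normedModType R) (f : V -> Z) (x v : V) :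
  'D_v f x = 'D_1 (fun h : R => f (h *: v + x)) 0.
Proof.
rewrite /derive; set g1 := fun h => h^-1 *: _; set g2 := fun h => h^-1 *: _.
suff -> : g1 = g2 by [].
rewrite funeqE /g1 /g2 => h /=.
by rewrite addr0 scale0r add0r [h *: 1]mulr1.
Qed.

(** Only [g] has to be Frechet differentiable: along the line [h *: v + x] the maps [a] and [b]
    become functions of one real variable, for which derivability and differentiability agree. *)
Lemma is_derive_comp_pair (V Y1 Y2 Z : normedModType R) (g : Y1 * Y2 -> Z)
    (a : V -> Y1) (b : V -> Y2) (x v : V) :
  differentiable g (a x, b x) -> derivable a x v -> derivable b x v ->
  is_derive x v (fun y => g (a y, b y)) ('d g (a x, b x) ('D_v a x, 'D_v b x)).
Proof.
move=> dg /derivable1P/derivable1_diffP da /derivable1P/derivable1_diffP db.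
pose k (h : R) := (a (h *: v + x), b (h *: v + x)).
have k0 : k 0 = (a x, b x) by rewrite /k scale0r add0r.
have dk : differentiable k 0.
  exact: (differentiable_pair da db).
have dgk : differentiable (g \o k) 0.
  by apply: differentiable_comp => //; rewrite k0.
split.
  by apply/derivable1P/derivable1_diffP.
rewrite derive_line (_ : (fun h : R => _) = g \o k)// deriveE// diff_comp//.
  rewrite k0 (diff_pair da db) (derive_line a) (derive_line b).
  by rewrite (deriveE _ da) (deriveE _ db).
by rewrite k0.
Qed.

Lemma Ck_continuous (V Z : normedModType R) k (U : set V) (f : V -> Z) x :
  Ck k U f -> U x -> {for x, continuous f}.
Proof. by case: k => [|k] [H _]; exact: H. Qed.

Lemma Ck_sub (V Z : normedModType R) k (U U' : set V) (f : V -> Z) :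
  U' `<=` U -> Ck k U f -> Ck k U' f.
Proof.
move=> sU; elim: k f => [|k IH] f [cf Hf]; split => //; try by move=> x /sU /cf.
by move=> v; have [df Df] := Hf v; split; [move=> x /sU /df|exact: IH].
Qed.

Lemma CkW (V Z : normedModType R) k (U : set V) (f : V -> Z) :
  Ck k.+1 U f -> Ck k U f.
Proof.
elim: k f => [|k IH] f [cf Hf]; split => // v.
by have [df Df] := Hf v; split => //; exact: IH.
Qed.

(** Derivatives at [x] see the values near [x], which lie in [U] since [U] is open; the equality
    thus passes to every ['D_v] and the induction continues with these. *)
Lemma Ck_ext (V Z : normedModType R) k (U : set V) (f g : V -> Z) :
  open U -> (forall x, U x -> f x = g x) -> Ck k U f -> Ck k U g.
Proof.
move=> oU; elim: k f g => [|k IH] f g fg [cf Hf].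
all: have fgn x : U x -> \near x, f x = g x
  by move=> Ux; apply: filterS (open_nbhs_nbhs (conj oU Ux)) => y /fg.
all: have cg x : U x -> {for x, continuous g}
  by move=> Ux; rewrite /prop_for /continuous_at -fg//;
     apply: cvg_trans (cf x Ux); apply: near_eq_cvg; exact: fgn.
  by split.
split => // v; have [df Df] := Hf v; split.
  by move=> x Ux; apply: near_eq_derivable (df x Ux); exact: fgn.
apply: IH Df => x Ux; apply: near_eq_derive; exact: fgn.
Qed.

Lemma Ck_cst (V Z : normedModType R) k (U : set V) (c : Z) : Ck k U (cst c).
Proof.
elim: k c => [|k IH] c; split => //; try by move=> x _; exact: cst_continuous.
move=> v; split; first by move=> x _; exact: derivable_cst.
rewrite (_ : 'D_v (cst c) = cst 0)//.
by apply/funext => x; rewrite derive_cst.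
Qed.

Lemma Ck_linear (V Z : normedModType R) k (U : set V) (f : V -> Z) :
  linear f -> continuous f -> Ck k U f.
Proof.
move=> lf cf; pose fL : {linear V -> Z} := HB.pack f (GRing.isLinear.Build _ _ _ _ f lf).
rewrite -[f]/(fL : V -> Z) in cf *; case: k => [|k]; split => //; try by move=> x _;
  exact: cf.
have fd x : differentiable fL x by exact: linear_differentiable.
move=> v; split; first by move=> x _; exact: diff_derivable.
rewrite (_ : 'D_v fL = cst (fL v)); first exact: Ck_cst.
by apply/funext => x; rewrite deriveE// diff_lin.
Qed.

Lemma CkD (V Z : normedModType R) k (U : set V) (f g : V -> Z) :
  open U -> Ck k U f -> Ck k U g -> Ck k U (f + g).
Proof.
move=> oU; elim: k f g => [|k IH] f g [cf Hf] [cg Hg]; split => //;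
  try by move=> x Ux; apply: continuousD; [exact: cf|exact: cg].
move=> v; have [df Df] := Hf v; have [dg Dg] := Hg v; split.
  by move=> x Ux; apply: derivableD; [exact: df|exact: dg].
apply: Ck_ext (IH _ _ Df Dg) => // x Ux.
by rewrite deriveD//; [exact: df|exact: dg].
Qed.

Lemma CkM (V : normedModType R) k (U : set V) (f g : V -> R^o) :
  open U -> Ck k U f -> Ck k U g -> Ck k U (f * g : V -> R^o).
Proof.
move=> oU; elim: k f g => [|k IH] f g Cf Cg.
all: have [cf Hf] := Cf; have [cg Hg] := Cg; split => //;
  try by move=> x Ux; apply: continuousM; [exact: cf|exact: cg].
move=> v; have [df Df] := Hf v; have [dg Dg] := Hg v; split.
  by move=> x Ux; apply: derivableM; [exact: df|exact: dg].
apply: (@Ck_ext _ _ _ _ (f * 'D_v g + g * 'D_v f : V -> R^o)) => //.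
  by move=> x Ux; rewrite deriveM//; [exact: df|exact: dg].
by apply: CkD => //; apply: IH => //; exact: CkW.
Qed.

Lemma Ck_sum (V Z : normedModType R) (I : Type) (s : seq I) k (U : set V)
    (f : I -> V -> Z) :
  open U -> (forall i, Ck k U (f i)) -> Ck k U (\sum_(i <- s) f i).
Proof.
move=> oU Hf; elim: s => [|i s IH]; first by rewrite big_nil; exact: Ck_cst.
by rewrite big_cons; exact: CkD.
Qed.

Lemma CkP_rV (V : normedModType R) m k (U : set V) (f : V -> 'rV[R]_m) :
  open U -> Ck k U f <-> forall i, Ck k U (fun x => f x 0 i : R^o).
Proof.
move=> oU; elim: k f => [|k IH] f; split.
- move=> [cf _] i; split => // x Ux.
  apply: (@continuous_comp _ _ _ f (fun v : 'rV[R]_m => v 0 i)); first exact: cf.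
  exact: coord_continuous.
- move=> H; split => // x Ux; apply/cvgrPdist_lt => e e0.
  have : \forall y \near x, forall i, `|f x 0 i - f y 0 i| < e.
    apply: filter_forall => i; have [/(_ x Ux)/cvgrPdist_lt c _] := H i; exact: c.
  apply: filterS => y Hy; rewrite /Num.Def.normr/= mx_normrE.
  by apply/bigmax_ltP; split => // -[i j] _; rewrite !mxE (ord1 i).
- move=> [cf Hf] i; split.
    move=> x Ux.
    apply: (@continuous_comp _ _ _ f (fun v : 'rV[R]_m => v 0 i)).
      exact: cf.
    exact: coord_continuous.
  move=> v; have [df Df] := Hf v; split.
    by move=> x /df /derivable_mxP; exact.
  have := (IH _).1 Df i; apply: Ck_ext => // x Ux.
  by rewrite derive_mx ?mxE//; exact: df.
- move=> H; split.
    have H0 : Ck k U f by apply/IH => i; apply: CkW.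
    by move=> x Ux; exact: Ck_continuous H0 Ux.
  have df v x : U x -> derivable f x v.
    move=> Ux; apply/derivable_mxP => i j; rewrite (ord1 i).
    have [_ /(_ v)[+ _]] := H j; exact.
  move=> v; split; first exact: df.
  apply/IH => i; have [_ /(_ v)[_]] := H i; apply: Ck_ext => // x Ux.
  by rewrite derive_mx ?mxE//; exact: df.
Qed.

Lemma Ck1_differentiable m (g : W m -> R^o) (P : set (W m)) x :
  open P -> P x -> Ck 1 P g ->
  differentiable g x /\
  forall v, 'D_v g x = \sum_(i <- directions m) coordinate v i * 'D_(direction i) g x.
Proof.
move=> oP Px [_ Hg]; apply: (C1_differentiable oP Px).
  by move=> v y Py; have [+ _] := Hg v; exact.
by move=> v; have [_ [+ _]] := Hg v; exact.
Qed.

(** By the chain rule, ['D_v] of the composite is a finite sum of products of a coordinate of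
    [('D_v a, 'D_v b)] with ['D_(direction i) g] at [(a, b)]. The basis directions are fixed, so the
    second factor is again covered by the induction hypothesis. *)
Lemma Ck_comp1 (V : normedModType R) m k (U : set V) (P : set (W m))
    (g : W m -> R^o) (a : V -> R^o) (b : V -> 'rV[R]_m) :
  open U -> open P -> (forall x, U x -> P (a x, b x)) ->
  Ck k P g -> Ck k U a -> Ck k U b -> Ck k U (fun x => g (a x, b x)).
Proof.
move=> oU oP UP; elim: k g => [|k IH] g Cg Ca Cb.
all: have cc x : U x -> {for x, continuous (fun x => g (a x, b x))}
  by move=> Ux; apply: (@continuous_comp _ _ _ (fun x => (a x, b x)) g);
     [exact: (cvg_pair (Ck_continuous Ca Ux) (Ck_continuous Cb Ux))
     |apply: Ck_continuous Cg _; exact: UP].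
  by split.
split => // v.
have [_ /(_ v)[da Da]] := Ca; have [_ /(_ v)[db Db]] := Cb.
have Cg1 : Ck 1 P g by move: (k) Cg; elim => // j + /CkW; apply.
have dgE x : U x -> is_derive x v (fun x => g (a x, b x))
    ('d g (a x, b x) ('D_v a x, 'D_v b x)).
  move=> Ux; apply: is_derive_comp_pair; [|exact: da|exact: db].
  exact: (Ck1_differentiable oP (UP _ Ux) Cg1).1.
split; first by move=> x /dgE[].
apply: (@Ck_ext _ _ _ _ (\sum_(i <- directions m) ((fun x =>
  coordinate ('D_v a x, 'D_v b x) i : R^o)
   * (fun x => 'D_(direction i) g (a x, b x) : R^o)))) => //.
  move=> x Ux; have [dg gE] := Ck1_differentiable oP (UP _ Ux) Cg1.
  by have [_ ->] := dgE x Ux; rewrite -deriveE// gE fct_sumE.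
apply: Ck_sum => // i; apply: CkM => //.
  by case: i => [i|] //=; exact: ((CkP_rV k ('D_v b) oU).1 Db).
by apply: (IH ('D_(direction i) g));
  [have [_ /(_ (direction i))[]] := Cg|exact: CkW|exact: CkW].
Qed.

Lemma Ck_comp (V : normedModType R) m p k (U : set V) (P : set (W m))
    (g : W m -> 'rV[R]_p) (a : V -> R^o) (b : V -> 'rV[R]_m) :
  open U -> open P -> (forall x, U x -> P (a x, b x)) ->
  Ck k P g -> Ck k U a -> Ck k U b -> Ck k U (fun x => g (a x, b x)).
Proof.
move=> oU oP UP /(CkP_rV _ _ oP) Cg Ca Cb; apply/CkP_rV => // i.
exact: (Ck_comp1 oU oP UP (Cg i)).
Qed.

Lemma Ck1_differentiable_rV m p (g : W m -> 'rV[R]_p) (P : set (W m)) x :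
  open P -> P x -> Ck 1 P g -> differentiable g x.
Proof.
move=> oP Px Cg.
rewrite (_ : g = \sum_(i < p) (fun w => g w 0 i *: (delta_mx 0 i : 'rV[R]_p))).
  apply: differentiable_sum => i; apply: differentiableZl.
  have := (CkP_rV _ _ oP).1 Cg i => Ci.
  exact: (Ck1_differentiable oP Px Ci).1.
by apply/funext => w; rewrite fct_sumE -row_sum_delta.
Qed.

End Ck_theory.

(** * Smooth families of maps read in charts *)

Section smooth_families.
Context {R : realType}.
Local Notation W m := (R^o * 'rV[R]_m)%type.

Lemma mulr_itv01 (s t : R) : s \in `[0, 1] -> t \in `[0, 1] -> s * t \in `[0, 1].
Proof.
rewrite !in_itv /= => /andP[s0 s1] /andP[t0 t1].
by rewrite mulr_ge0// mulr_ile1.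
Qed.

Lemma open_slice_space m (P : set (W m)) (t : R) :
  open P -> open ((fun y => (t, y) : W m) @^-1` P).
Proof.
move=> oP; apply: open_comp => // z _.
exact: (@cvg_pair _ _ _ (nbhs z) (nbhs (t : R^o)) (nbhs z) _ _ _ (cst (t : R^o)) id
  (cvg_cst _) cvg_id).
Qed.

Lemma open_slice_time m (P : set (W m)) (y : 'rV[R]_m) :
  open P -> open ((fun s : R => (s, y) : W m) @^-1` P).
Proof.
move=> oP; apply: open_comp => // z _.
exact: (@cvg_pair _ _ _ (nbhs z) (nbhs (z : R^o)) (nbhs y) _ _ _ id (cst y)
  cvg_id (cvg_cst _)).
Qed.

(** Continuity relative to [[0, 1] * X], written with neighborhoods of the whole product and an
    implication on times; compositions and changes of time are then handled without subspace
    topologies. *)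
Definition jointly_continuous (X Y : topologicalType) (K : R -> X -> Y) :=
  forall t x (A : set Y), t \in `[0, 1] -> nbhs (K t x) A ->
    \forall p \near (t, x), p.1 \in `[0, 1] -> A (K p.1 p.2).

Lemma jointly_continuousP (X Y : topologicalType) (K : R -> X -> Y) :
  {within `[0, 1] `*` [set: X], continuous (fun p : R * X => K p.1 p.2)} <->
  jointly_continuous K.
Proof.
split.
  move=> /subspace_continuousP H t x A t01 FA.
  have D : (`[0, 1] `*` [set: X]) (t, x) by [].
  have := H _ D A FA; rewrite /nbhs /= /within /=.
  by apply: filterS => p /= Hp p01; apply: Hp.
move=> H; apply/subspace_continuousP => -[t x] [/= t01 _] A FA.
have := H t x A t01 FA; rewrite nbhs_simpl /within /=.
by apply: filterS => p /= Hp [p01 _]; apply: Hp.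
Qed.

Lemma continuous_familyP (M : topologicalType) (F : R -> M -> M) :
  continuous_family F <-> jointly_continuous F.
Proof. exact: jointly_continuousP. Qed.

Lemma jointly_continuous_comp (X Y Z : topologicalType) (F : R -> Y -> Z)
    (G : R -> X -> Y) :
  jointly_continuous F -> jointly_continuous G ->
  jointly_continuous (fun t => F t \o G t).
Proof.
move=> cF cG t x A t01 FA.
have [[P Q] /= [Pt QG] PQ] := cF t (G t x) A t01 FA.
have := cG t x Q t01 QG.
have : \forall p \near (t, x), P p.1 by apply: cvg_fst.
apply: filterS2 => -[s y] /= Ps Qs s01.
by apply: (PQ (s, G s y)) => //; split => //=; exact: Qs.
Qed.

Lemma open_preimage_in (X Y : topologicalType) (f : X -> Y) (A : set X) (B : set Y) :
  open A -> open B -> (forall x, A x -> {for x, continuous f}) ->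
  open (A `&` f @^-1` B).
Proof.
move=> oA oB cf; rewrite openE => x [Ax Bfx]; apply: filterI.
  exact: open_nbhs_nbhs.
by apply: cf => //; exact: open_nbhs_nbhs.
Qed.

Section local_extensions.
Context {M : topologicalType} {m : nat} (S : smooth_structure R M m).

(** [G] is smooth on an open set, so the calculus above applies at the end times too. It represents
    [F] at times in [[0, 1]] only; elsewhere its values are arbitrary. [P] is kept so small that the
    reading stays inside the charts. *)
Definition smooth_extension (F : R -> M -> M) (c c' : chart R M m)
    (P : set (W m)) (G : W m -> 'rV[R]_m) :=
  [/\ open P, forall k, Ck k P G & forall t y, t \in `[0, 1] -> P (t, y) ->
    [/\ ccod c y, cdom c' (F t (cinv c y)) & G (t, y) = cfun c' (F t (cinv c y))]].

(** The open set given by [smooth_family] is cut down to points where times in [[0, 1]] keep [F]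
    inside [cdom c']; continuity of the family puts the given point in the interior of that set. *)
Lemma smooth_family_extension (F : R -> M -> M) c c' (t : R) x :
  smooth_family S F -> atlas S c -> atlas S c' -> t \in `[0, 1] ->
  cdom c x -> cdom c' (F t x) ->
  exists P G, smooth_extension F c c' P G /\ P (t, cfun c x).
Proof.
move=> [cF sF] Sc Sc' t01 cx cFx.
have A0 : [set p : W m | [/\ p.1 \in `[0, 1], ccod c p.2 &
    cdom c' (F p.1 (cinv c p.2))]] (t, cfun c x).
  by split => //=; [exact: chart_fun_cod|rewrite chart_funK].
have [P [G [oO Px GC GE]]] := sF c c' Sc Sc' _ A0.
have N : \forall p \near ((t, cfun c x) : W m), ccod c p.2 /\
    (p.1 \in `[0, 1] -> cdom c' (F p.1 (cinv c p.2))).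
  apply: filterI.
    have cs : (@snd R^o 'rV[R]_m) @ ((t, cfun c x) : W m) --> cfun c x.
      exact: cvg_snd.
    apply: cs; apply: open_nbhs_nbhs.
    by split; [exact: chart_open_cod|exact: chart_fun_cod].
  have /continuous_familyP /(_ t x (cdom c') t01) := cF.
  move=> /(_ (open_nbhs_nbhs (conj (chart_open_dom c') cFx))) H.
  have cc : (fun p : W m => (p.1 : R, cinv c p.2)) @ ((t, cfun c x) : W m)
      --> (t, x).
    have c2 : (fun p : W m => cinv c p.2) @ ((t, cfun c x) : W m) --> x.
      have := chart_inv_continuous (chart_fun_cod cx).
      rewrite /prop_for /continuous_at chart_funK// => ci.
      exact: (cvg_comp _ _ cvg_snd ci).
    exact: (cvg_pair cvg_fst c2).
  exact: (cc _ H).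
exists (P `&` interior [set p | ccod c p.2 /\
    (p.1 \in `[0, 1] -> cdom c' (F p.1 (cinv c p.2)))]), G; split; last first.
  by split.
split; first by apply: openI => //; exact: open_interior.
  by move=> k; apply: Ck_sub (GC k); exact: subIsetl.
move=> s y s01 [Psy /interior_subset [/= cy /(_ s01) Fy]].
by split => //; apply: GE.
Qed.

Lemma smooth_family_from_extensions (F : R -> M -> M) :
  continuous_family F ->
  (forall c c' (t : R) x, atlas S c -> atlas S c' -> t \in `[0, 1] ->
    cdom c x -> cdom c' (F t x) ->
    exists P G, smooth_extension F c c' P G /\ P (t, cfun c x)) ->
  smooth_family S F.
Proof.
move=> cF H; split => // c c' Sc Sc' [t y] [/= t01 cy Fy].
have [P [G [[oO CG GE] Pty]]] := H c c' t _ Sc Sc' t01 (chart_inv_dom cy) Fy.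
exists P, G; rewrite chart_invK in Pty => //; split => //.
by move=> [s z] /= [s01 cz Fz] /(GE _ _ s01)[].
Qed.

(** The two readings meet in a chart [c1] around [G t x]: [f2 (p.1, g1 p)] extends the composite on
    the open set where [(p.1, g1 p)] lies in [P2]. *)
Lemma smooth_family_comp (F G : R -> M -> M) :
  smooth_family S F -> smooth_family S G ->
  smooth_family S (fun t => F t \o G t).
Proof.
move=> sF sG; apply: smooth_family_from_extensions.
  by apply/continuous_familyP; apply: jointly_continuous_comp; apply/continuous_familyP;
    [exact: sF.1|exact: sG.1].
move=> c c' t x Sc Sc' t01 cx c'x.
have [c1 Sc1 c1x] := atlas_cover S (G t x).
have [P1 [g1 [[oO1 Cg1 g1E] P1x]]] := smooth_family_extension sG Sc Sc1 t01 cx c1x.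
have [P2 [f2 [[oO2 Cf2 f2E] P2x]]] := smooth_family_extension sF Sc1 Sc' t01 c1x c'x.
have g1x : g1 (t, cfun c x) = cfun c1 (G t x).
  by have [_ _ ->] := g1E _ _ t01 P1x; rewrite chart_funK.
have cp : forall p, P1 p -> {for p, continuous (fun p : W m => (p.1, g1 p) : W m)}.
  by move=> p P1p; exact: (cvg_pair cvg_fst (Ck_continuous (Cg1 0) P1p)).
exists (P1 `&` (fun p : W m => (p.1, g1 p) : W m) @^-1` P2),
  (fun p => f2 (p.1, g1 p)); split; last first.
  by split => //=; rewrite g1x.
have oO : open (P1 `&` (fun p : W m => (p.1, g1 p) : W m) @^-1` P2).
  exact: open_preimage_in.
split => //.
  move=> k; apply: (Ck_comp (P := P2) (a := fun p : W m => p.1)) => //.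
  - by move=> p [].
  - by apply: (@Ck_linear _ _ _ _ _ (@fst R^o 'rV[R]_m)) => // p; exact: cvg_fst.
  - by apply: Ck_sub (Cg1 k); exact: subIsetl.
move=> s y s01 [P1s /= P2s]; have [cy G1 g1s] := g1E _ _ s01 P1s.
have := f2E _ _ s01 P2s; rewrite g1s chart_funK// => -[_ F2 ->].
by split.
Qed.

Lemma continuous_family_reparam (F : R -> M -> M) (s : R) : s \in `[0, 1] ->
  continuous_family F -> continuous_family (fun t => F (s * t)).
Proof.
move=> s01 /continuous_familyP cF; apply/continuous_familyP => t x A t01 FA.
have H := cF _ x A (mulr_itv01 s01 t01) FA.
have cc : (fun p : R * M => (s * p.1, p.2)) @ (t, x) --> (s * t, x).
  have c1 : (fun p : R * M => s * p.1) @ (t, x) --> s * t.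
    by apply: cvgMr; exact: cvg_fst.
  exact: (cvg_pair c1 cvg_snd).
have H' : \forall p \near (t, x), s * p.1 \in `[0, 1] -> A (F (s * p.1) p.2).
  exact: (cc _ H).
by apply: filterS H' => p Hp p01; apply: Hp; exact: mulr_itv01.
Qed.

Lemma smooth_family_reparam (F : R -> M -> M) (s : R) : s \in `[0, 1] ->
  smooth_family S F -> smooth_family S (fun t => F (s * t)).
Proof.
move=> s01 sF; apply: smooth_family_from_extensions.
  by apply: continuous_family_reparam => //; exact: sF.1.
move=> c c' t x Sc Sc' t01 cx c'x.
have [P [f [[oO Cf fE] Px]]] :=
  smooth_family_extension sF Sc Sc' (mulr_itv01 s01 t01) cx c'x.
have c1 : continuous (fun p : W m => s *: p.1).
  by move=> p; apply: cvgZr; exact: cvg_fst.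
have oO' : open ((fun p : W m => (s *: p.1, p.2) : W m) @^-1` P).
  by apply: open_comp => // p _; exact: (cvg_pair (c1 p) cvg_snd).
exists ((fun p : W m => (s *: p.1, p.2) : W m) @^-1` P),
  (fun p => f (s *: p.1, p.2)); split => //; split => //.
  move=> k; apply: (Ck_comp (P := P) (a := fun p : W m => s *: p.1)
     (b := fun p : W m => p.2)) => //.
  - apply: Ck_linear => // a u v /=; rewrite scalerDr !scalerA; congr (_ *: _ + _).
    exact: mulrC.
  - by apply: (@Ck_linear _ _ _ _ _ (@snd R^o 'rV[R]_m)) => // p; exact: cvg_snd.
move=> r y r01 /= Pr; exact: (fE _ _ (mulr_itv01 s01 r01) Pr).
Qed.

Lemma smooth_family_map (F : R -> M -> M) (t : R) : t \in `[0, 1] ->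
  smooth_family S F -> smooth_map S (F t).
Proof.
move=> t01 sF; split.
  move=> x A FA; have /continuous_familyP cF := sF.1.
  have cc : (fun y : M => (t, y)) @ x --> (t, x).
    exact: (cvg_pair (cvg_cst _) cvg_id).
  have H' : \forall y \near x, t \in `[0, 1] -> A (F t y).
    exact: (cc _ (cF t x A t01 FA)).
  change (\forall y \near x, A (F t y)).
  by apply: filterS H' => y; exact.
move=> c c' Sc Sc' y [cy c'y].
have [P [f [[oO Cf fE] Px]]] :=
  smooth_family_extension sF Sc Sc' t01 (chart_inv_dom cy) c'y.
rewrite chart_invK in Px => //.
have oO' : open ((fun y => (t, y) : W m) @^-1` P) by exact: open_slice_space.
exists ((fun y => (t, y) : W m) @^-1` P), (fun y => f (t, y)); split => //.
  move=> k; apply: (Ck_comp (P := P) (a := cst (t : R^o)) (b := id)) => //.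
    exact: Ck_cst.
  by apply: Ck_linear => // z; exact: cvg_id.
by move=> z _ /= /(fE _ _ t01)[_ _ ->].
Qed.

End local_extensions.

End smooth_families.

Definition inv_homeo (M : topologicalType) (f : homeo M) : homeo M :=
  Homeo (@hinv_continuous _ f) (@hfun_continuous _ f) (@hinvK _ f) (@hfunK _ f).

(** * Velocities, left division and change of speed of smooth systems *)

Section smooth_systems.
Context {R : realType}.
Local Notation W m := (R^o * 'rV[R]_m)%type.

Lemma pairingD m (a u v : 'rV[R]_m) : pairing a (u + v) = pairing a u + pairing a v.
Proof.
by rewrite /pairing -big_split; apply: eq_bigr => i _; rewrite !mxE mulrDr.
Qed.

Lemma pairingZ m (a : 'rV[R]_m) k v : pairing a (k *: v) = k * pairing a v.
Proof.
by rewrite /pairing mulr_sumr; apply: eq_bigr => i _; rewrite !mxE mulrCA.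
Qed.

Lemma cvg_pairing (T : Type) (F : set_system T) (FF : Filter F) m
    (f g : T -> 'rV[R]_m) a b :
  f @ F --> a -> g @ F --> b -> (fun x => pairing (f x) (g x)) @ F --> pairing a b.
Proof.
move=> fa gb; apply: cvg_big => [|i _]; first exact: add_continuous.
apply: cvgM.
- exact: (cvg_comp _ _ fa (@coord_continuous R 1 m 0 i a)).
- exact: (cvg_comp _ _ gb (@coord_continuous R 1 m 0 i b)).
Qed.

Lemma near_eq_open (V : topologicalType) (U : set V) (P : V -> Prop) x :
  open U -> U x -> (forall y, U y -> P y) -> \forall y \near x, P y.
Proof.
move=> oU Ux UP; apply: (@filterS _ (nbhs x) _ U) => //.
exact: open_nbhs_nbhs.
Qed.

Lemma derive_slice1 m (Z : normedModType R) (G : W m -> Z) (t : R) (y : 'rV[R]_m) :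
  differentiable G ((t, y) : W m) ->
  is_derive t 1 (fun s : R => G (s, y)) ('D_((1, 0) : W m) G (t, y)).
Proof.
move=> dG; have : derivable G ((t, y) : W m) ((1, 0) : W m) by exact: diff_derivable.
have E : (fun h : R => h^-1 *: (((fun s => G (s, y)) \o shift t) (h *: 1) - G (t, y))) =
    (fun h : R => h^-1 *: ((G \o shift ((t, y) : W m)) (h *: ((1, 0) : W m)) - G (t, y))).
  apply/funext => h /=; congr (_ *: (G _ - _)).
  by congr (_, _); rewrite /= ?scaler0 ?add0r.
by move=> dd; split; rewrite /derivable /derive E.
Qed.

Lemma derive_slice2 m (Z : normedModType R) (G : W m -> Z) (t : R)
    (y v : 'rV[R]_m) :
  differentiable G ((t, y) : W m) ->
  is_derive y v (fun z => G (t, z)) ('D_((0, v) : W m) G (t, y)).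
Proof.
move=> dG; have : derivable G ((t, y) : W m) ((0, v) : W m) by exact: diff_derivable.
have E : (fun h : R => h^-1 *: (((fun z => G (t, z)) \o shift y) (h *: v) - G (t, y))) =
    (fun h : R => h^-1 *: ((G \o shift ((t, y) : W m)) (h *: ((0, v) : W m)) - G (t, y))).
  apply/funext => h /=; congr (_ *: (G _ - _)).
  by congr (_, _); rewrite /= ?scaler0 ?add0r.
by move=> dd; split; rewrite /derivable /derive E.
Qed.

Lemma smooth_extension_diff (M : topologicalType) m (F : R -> M -> M)
    (c c' : chart R M m) (P : set (W m)) G p :
  smooth_extension F c c' P G -> P p -> differentiable G p.
Proof. by move=> [oP CG _] Pp; apply: Ck1_differentiable_rV oP Pp (CG 1). Qed.

Section velocities.
Context {M : pointedMetricType R} {n : nat}.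
Context (S : smooth_structure R M n.*2.+1) (alpha : form_coefs R M n.*2.+1).
Local Notation m := (n.*2.+1).

Lemma derive_smooth_extension (F : R -> M -> M) c c' (P : set (W m)) G t x v :
  smooth_extension F c c' P G -> t \in `[0, 1] -> P (t, cfun c x) ->
  'D_v (cfun c' \o F t \o cinv c) (cfun c x) = 'D_((0, v) : W m) G (t, cfun c x).
Proof.
move=> eG t01 Px; have dG := smooth_extension_diff eG Px.
have [_ <-] := derive_slice2 v dG; apply: near_eq_derive.
have [oP _ GE] := eG.
have oP' : open ((fun y => (t, y) : W m) @^-1` P) by exact: open_slice_space.
apply: (near_eq_open oP') => // y Py /=.
by have [_ _ ->] := GE _ _ t01 Py.
Qed.

(** At an end time the velocity is one-sided; it is still the ordinary derivative of any
    differentiable [k] that agrees with the path at nearby times in [[0, 1]]. *)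
Lemma velocity_derive (Phi : R -> homeo M) (k : R -> 'rV[R]_m) t x c :
  t \in `[0, 1] -> derivable k t 1 ->
  (\forall s \near t, s \in `[0, 1] -> cfun c (Phi s x) = k s) ->
  is_velocity Phi t x c ('D_1 k t).
Proof.
move=> t01 dk Hk; rewrite /is_velocity.
have kt : cfun c (Phi t x) = k t by exact: (nbhs_singleton Hk).
have cw : (fun h : R => h^-1 *: (k (h *: 1 + t) - k t)) @
    within [set h | t + h \in `[0, 1]] 0^' --> 'D_1 k t.
  have dk' : (fun h : R => h^-1 *: (k (h *: 1 + t) - k t)) @ 0^' --> 'D_1 k t.
    exact: dk.
  by apply: cvg_trans dk'; apply: cvg_fmap2; exact: cvg_within.
apply: cvg_trans cw; apply: near_eq_cvg.
have Ht : \forall h \near (0 : R), t + h \in `[0, 1] ->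
  cfun c (Phi (t + h) x) = k (t + h).
  have ct : (fun h : R => t + h) @ (0 : R) --> t.
    by rewrite -[X in _ --> X]addr0; apply: cvgD; [exact: cvg_cst|exact: cvg_id].
  exact: (ct _ Hk).
have Ht' : \forall h \near 0^', t + h \in `[0, 1] -> cfun c (Phi (t + h) x) = k (t + h).
  exact: cvg_within Ht.
near=> h.
have th01 : t + h \in `[0, 1] by near: h; exact: withinT.
have -> : cfun c (Phi (t + h) x) = k (t + h).
  by move: th01; near: h; exact: cvg_within Ht'.
by rewrite kt [h *: 1]mulr1 (addrC t).
Unshelve. all: by end_near. Qed.

(** Arbitrarily small admissible nonzero increments exist at every time, end times included, which
    makes velocities unique. Uniqueness identifies the vector provided by [generates] with the
    derivative computed from an extension. *)
Lemma within_itv_proper (t : R) : t \in `[0, 1] ->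
  ProperFilter (within [set h : R | t + h \in `[0, 1]] 0^').
Proof.
rewrite in_itv /= => /andP[t0 t1].
split; last exact: within_filter.
rewrite /within /= => /nbhs_ballP[e /= e0 H].
(* The increment points towards the middle of the interval, forward if [t <= 1 / 2] and backward
   otherwise; a length of at most [1 / 2] keeps the time in [[0, 1]]. *)
pose d := Num.min (e / 2) (1 / 2).
have d0 : 0 < d by rewrite lt_min !divr_gt0.
have de : d < e by rewrite gt_min ltr_pdivrMr// ltr_pMr// ltr1n.
have d1 : d <= 1 / 2 by rewrite ge_min lexx orbT.
case: (leP t (1 / 2)) => th.
- apply: (H d); rewrite /ball /= ?sub0r ?normrN ?gtr0_norm//; first by rewrite gt_eqF.
  by rewrite in_itv /=; apply/andP; split; lra.
- apply: (H (- d)); rewrite /ball /= ?sub0r ?opprK ?gtr0_norm//;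
  first by rewrite oppr_eq0 gt_eqF.
  by rewrite in_itv /=; apply/andP; split; lra.
Qed.

Lemma velocity_unique (Phi : R -> homeo M) t x c (u v : 'rV[R]_m) :
  t \in `[0, 1] -> is_velocity Phi t x c u -> is_velocity Phi t x c v -> u = v.
Proof.
move=> t01 Hu Hv; have PF := within_itv_proper t01.
exact: (cvg_unique (@norm_hausdorff _ _) Hu Hv).
Qed.

Lemma velocity_smooth_extension (Phi : R -> homeo M) c c' (P : set (W m)) G t x :
  smooth_extension (fun t => Phi t) c c' P G -> t \in `[0, 1] ->
  cdom c x -> P (t, cfun c x) ->
  is_velocity Phi t x c' ('D_((1, 0) : W m) G (t, cfun c x)).
Proof.
move=> eG t01 cx Px; have [d1 <-] := derive_slice1 (smooth_extension_diff eG Px).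
apply: velocity_derive => //.
have [oP _ GE] := eG.
have oP' : open ((fun s : R => (s, cfun c x) : W m) @^-1` P) by exact: open_slice_time.
apply: (near_eq_open oP') => // s Ps s01.
by have [_ _ ->] := GE _ _ s01 Ps; rewrite chart_funK.
Qed.

Section quotient.
Variables (Phi Psi : R -> homeo M) (H F : R -> M -> R).
Hypotheses (sPhi : smooth_scds S alpha Phi H) (sPsi : smooth_scds S alpha Psi F).

Let Chi t := comp_homeo (inv_homeo (Phi t)) (Psi t).

Let PhiChi t x : Phi t (Chi t x) = Psi t x.
Proof. exact: hinvK. Qed.

Let smooth_Phi : smooth_family S (fun t => Phi t).
Proof. by case: sPhi => -[[]]. Qed.

(** The inverse of [Chi t] is [hinv (Psi t) \o Phi t], and [smooth_isotopy] carries smoothness of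
    inverses, so both families are composites of given smooth ones. *)
Lemma smooth_isotopy_quotient : smooth_isotopy S Chi.
Proof.
case: sPhi => -[[sF sFi F0] _] _; case: sPsi => -[[sG sGi G0] _] _; split.
- exact: (smooth_family_comp sFi sG).
- exact: (smooth_family_comp sGi sF).
- by move=> x; rewrite /= G0 -[in LHS](F0 x) hfunK.
Qed.

Let smooth_Chi : smooth_family S (fun t => Chi t).
Proof. by case: smooth_isotopy_quotient. Qed.

(* Since phi_t \o chi_t = psi_t, the derivative of phi_t maps that of chi_t to
   that of psi_t; no inverse of a derivative is needed. *)
Lemma pulls_back_quotient t : t \in `[0, 1] -> pulls_back S alpha (Chi t) (cst 1).
Proof.
move=> t01 c c' x v Sc Sc' cx c'x.
have [c2 Sc2 c2x] := atlas_cover S (Psi t x).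
have c2x' : cdom c2 (Phi t (Chi t x)) by rewrite PhiChi.
have [P1 [g [eg P1x]]] := smooth_family_extension smooth_Chi Sc Sc' t01 cx c'x.
have [P2 [f [ef P2x]]] := smooth_family_extension smooth_Phi Sc' Sc2 t01 c'x c2x'.
have [oP1 Cg gE] := eg; have [oP2 Cf fE] := ef.
have gx : g (t, cfun c x) = cfun c' (Chi t x).
  by have [_ _ ->] := gE _ _ t01 P1x; rewrite chart_funK.
rewrite (derive_smooth_extension _ eg t01 P1x).
set u := 'D_(_) g _.
have := sPhi.1.2 t t01 c' c2 (Chi t x) u Sc' Sc2 c'x c2x'.
rewrite !mul1r => <-; rewrite PhiChi.
have := sPsi.1.2 t t01 c c2 x v Sc Sc2 cx c2x; rewrite mul1r => <-.
congr pairing; rewrite (derive_smooth_extension _ ef t01 P2x).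
have dg := smooth_extension_diff eg P1x; have df := smooth_extension_diff ef P2x.
have [dg2 dg2E] := derive_slice2 v dg.
have dft : differentiable f ((cst (t : R^o) (cfun c x), g (t, cfun c x)) : W m).
  by rewrite /cst gx.
have [_] := is_derive_comp_pair dft (derivable_cst (t : R^o) (cfun c x) v) dg2.
rewrite derive_cst dg2E -/u gx -(deriveE _ df) => <-.
apply: near_eq_derive.
have oP : open (P1 `&` (fun p : W m => (p.1, g p) : W m) @^-1` P2).
  apply: open_preimage_in => // p P1p.
  exact: (cvg_pair cvg_fst (Ck_continuous (Cg 0) P1p)).
have oP' : open ((fun y => (t, y) : W m) @^-1`
   (P1 `&` (fun p : W m => (p.1, g p) : W m) @^-1` P2)).
  exact: open_slice_space.
have Px : ((fun y => (t, y) : W m) @^-1`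
   (P1 `&` (fun p : W m => (p.1, g p) : W m) @^-1` P2)) (cfun c x).
  by split => //=; rewrite gx.
apply: (near_eq_open oP' Px) => y [P1y /= P2y].
have [_ c'y gy] := gE _ _ t01 P1y; have [_ _ fy] := fE _ _ t01 P2y.
by rewrite /cst fy gy chart_funK// PhiChi.
Qed.

(* Differentiating phi_s (chi_s x) = psi_s x in s and pairing with alpha gives
   H + alpha(dphi_t v) = F at psi_t x, where v is the velocity of chi and
   alpha(dphi_t v) = alpha(v). *)
Lemma generates_quotient :
  generates S alpha Chi (fun t x => F t (Phi t x) - H t (Phi t x)).
Proof.
move=> t x c t01 Sc cx.
have [c1 Sc1 c1x] := atlas_cover S x.
have [c2 Sc2 c2x] := atlas_cover S (Psi t x).
have c2x' : cdom c2 (Phi t (Chi t x)) by rewrite PhiChi.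
have [P1 [g [eg P1x]]] := smooth_family_extension smooth_Chi Sc1 Sc t01 c1x cx.
have [P2 [f [ef P2x]]] := smooth_family_extension smooth_Phi Sc Sc2 t01 cx c2x'.
have [oP1 Cg gE] := eg; have [oP2 Cf fE] := ef.
have gx : g (t, cfun c1 x) = cfun c (Chi t x).
  by have [_ _ ->] := gE _ _ t01 P1x; rewrite chart_funK.
have dg := smooth_extension_diff eg P1x; have df := smooth_extension_diff ef P2x.
exists ('D_((1, 0) : W m) g (t, cfun c1 x)).
  exact: velocity_smooth_extension eg t01 c1x P1x.
set v := 'D_(_) g _; rewrite PhiChi.
have [dg1 dg1E] := derive_slice1 dg.
have dft : differentiable f ((id (t : R^o), g (t, cfun c1 x)) : W m) by rewrite gx.
have [dk dkE] := is_derive_comp_pair dft (@derivable_id R R^o t 1) dg1.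
rewrite derive_id dg1E -/v gx in dkE.
have oP : open (P1 `&` (fun p : W m => (p.1, g p) : W m) @^-1` P2).
  apply: open_preimage_in => // p P1p.
  exact: (cvg_pair cvg_fst (Ck_continuous (Cg 0) P1p)).
have oP' : open ((fun s : R => (s, cfun c1 x) : W m) @^-1`
   (P1 `&` (fun p : W m => (p.1, g p) : W m) @^-1` P2)).
  exact: open_slice_time.
have Px : ((fun s : R => (s, cfun c1 x) : W m) @^-1`
   (P1 `&` (fun p : W m => (p.1, g p) : W m) @^-1` P2)) t.
  by split => //=; rewrite gx.
have vPsi : is_velocity Psi t x c2 ('d f (t, cfun c (Chi t x)) (1, v)).
  rewrite -dkE; apply: velocity_derive => //.
  apply: (near_eq_open oP' Px) => s [P1s /= P2s] s01.
  have [_ cs gs] := gE _ _ s01 P1s; have [_ _ fs] := fE _ _ s01 P2s.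
  by rewrite /= fs gs chart_funK// PhiChi chart_funK.
have [v2 Hv2 ->] := sPsi.2 t x c2 t01 Sc2 c2x.
rewrite (velocity_unique t01 Hv2 vPsi).
have [u Hu] := sPhi.2 t (Chi t x) c2 t01 Sc2 c2x'; rewrite PhiChi => ->.
have vPhi := velocity_smooth_extension ef t01 cx P2x.
rewrite (velocity_unique t01 Hu vPhi).
have -> : ((1, v) : W m) = ((1, 0) : W m) + ((0, v) : W m).
  by congr (_, _); rewrite /= ?addr0 ?add0r.
rewrite linearD pairingD -!deriveE// addrAC subrr add0r.
have := sPhi.1.2 t t01 c c2 (Chi t x) v Sc Sc2 cx c2x'.
by rewrite mul1r PhiChi => <-; rewrite (derive_smooth_extension _ ef t01 P2x).
Qed.

Lemma smooth_scds_quotient :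
  smooth_scds S alpha Chi (fun t x => F t (Phi t x) - H t (Phi t x)).
Proof.
split; last exact: generates_quotient.
by split; [exact: smooth_isotopy_quotient|exact: pulls_back_quotient].
Qed.

End quotient.

(** The difference quotient of [Phi (s * t)] at [h] is [s] times that of [Phi] at [s * h], so the
    velocity, and with it the Hamiltonian, is multiplied by [s]. *)
Lemma smooth_scds_reparam (Phi : R -> homeo M) (H : R -> M -> R) (s : R) :
  s \in `[0, 1] -> smooth_scds S alpha Phi H ->
  smooth_scds S alpha (fun t => Phi (s * t)) (fun t x => s * H (s * t) x).
Proof.
move=> s01 [[[sF sFi F0] pF] gF]; split; first split; first split.
- exact: (smooth_family_reparam s01 sF).
- exact: (smooth_family_reparam s01 sFi).
- by rewrite mulr0.
- by move=> t t01; apply: pF; exact: mulr_itv01.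
move=> t x c t01 Sc cx.
have [v Hv ->] := gF _ x c (mulr_itv01 s01 t01) Sc cx.
exists (s *: v); last by rewrite pairingZ.
(* At [s = 0] the increments [s * h] leave the punctured neighborhoods of 0; the path is then
   constant with velocity 0. *)
have [->|s0] := eqVneq s 0.
  rewrite scale0r /is_velocity.
  under eq_fun do rewrite !mul0r subrr scaler0.
  exact: cvg_cst.
have sh : (fun h => s * h) @ within [set h | t + h \in `[0, 1]] 0^' -->
    within [set h | s * t + h \in `[0, 1]] 0^'.
  move=> A; rewrite /within /= => /nbhs_ballP[e /= e0 He].
  apply/nbhs_ballP; exists (e / `|s|) => /=; first by rewrite divr_gt0// normr_gt0.
  move=> h; rewrite /ball /= sub0r normrN => he h0 th.
  apply: He; rewrite /ball /= ?sub0r ?normrN.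
  - by rewrite normrM mulrC -ltr_pdivlMr ?normr_gt0.
  - by rewrite mulf_eq0 negb_or s0.
  - by rewrite -mulrDr; exact: mulr_itv01.
have Hs : (fun h => s *: ((s * h)^-1 *:
    (cfun c (Phi (s * t + s * h) x) - cfun c (Phi (s * t) x)))) @
    within [set h | t + h \in `[0, 1]] 0^' --> s *: v.
  exact: (cvgZ (cvg_cst s) (cvg_comp _ _ sh Hv)).
rewrite /is_velocity; apply: cvg_trans Hs; apply: near_eq_cvg; near=> h.
by rewrite /= invfM scalerA mulrA divff// mul1r mulrDr.
Unshelve. all: by end_near. Qed.

End velocities.
End smooth_systems.

Section smooth_hamiltonians.
Context {R : realType}.
Local Notation W m := (R^o * 'rV[R]_m)%type.

Lemma smooth_on_continuous (V Z : normedModType R) (A : set V) (f : V -> Z) x :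
  open A -> smooth_on A f -> A x -> {for x, continuous f}.
Proof.
move=> oA sf Ax; have [P [g [oP Px Cg gE]]] := sf x Ax.
have gfx : g x = f x by exact: gE.
rewrite /prop_for /continuous_at -gfx.
apply: cvg_trans (Ck_continuous (Cg 0) Px); apply: near_eq_cvg.
apply: (near_eq_open (openI oA oP)) => // y [Ay Py].
by rewrite gE.
Qed.

Context {M : pointedMetricType R} {n : nat}.
Context (S : smooth_structure R M n.*2.+1) (alpha : form_coefs R M n.*2.+1).
Local Notation m := (n.*2.+1).

(** By uniqueness of velocities, [H t (Phi t x)] is [alpha] paired with the time derivative of an
    extension, hence continuous; composition with the continuous inverse family gives [H] back. *)
Lemma jointly_continuous_hamiltonian (Phi : R -> homeo M) (H : R -> M -> R) :
  is_one_form S alpha -> smooth_scds S alpha Phi H -> jointly_continuous H.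
Proof.
move=> [sa _] [[[sPhi sPhii _] _] gPhi].
have cPhii : jointly_continuous (fun t => hinv (Phi t)).
  by apply/continuous_familyP; exact: sPhii.1.
suff cK : jointly_continuous (fun t x => H t (Phi t x)).
  have := jointly_continuous_comp cK cPhii.
  rewrite (_ : (fun t => _) = H)//.
  by apply/funext => t; apply/funext => x /=; rewrite hinvK.
move=> t x A t01 HA.
have [c1 Sc1 c1x] := atlas_cover S x.
have [c2 Sc2 c2x] := atlas_cover S (Phi t x).
have [P [G [eG Px]]] := smooth_family_extension sPhi Sc1 Sc2 t01 c1x c2x.
have [oP CG GE] := eG.
pose E p := pairing (alpha c2 (G p)) ('D_((1, 0) : W m) G p).
have HE s y : s \in `[0, 1] -> cdom c1 y -> P (s, cfun c1 y) ->
    H s (Phi s y) = E (s, cfun c1 y).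
  move=> s01 c1y Py; have [_ c2y Gy] := GE _ _ s01 Py; rewrite chart_funK// in c2y Gy.
  have [v Hv ->] := gPhi s y c2 s01 Sc2 c2y.
  by rewrite (velocity_unique s01 Hv (velocity_smooth_extension eG s01 c1y Py)) /E Gy.
have Gx : G (t, cfun c1 x) = cfun c2 (Phi t x).
  by have [_ _ ->] := GE _ _ t01 Px; rewrite chart_funK.
have cE : {for ((t, cfun c1 x) : W m), continuous E}.
  apply: cvg_pairing.
    have ca : {for G (t, cfun c1 x), continuous (alpha c2)}.
      apply: smooth_on_continuous (sa c2 Sc2) _; first exact: chart_open_cod.
      by rewrite Gx; exact: chart_fun_cod.
    exact: (continuous_comp (Ck_continuous (CG 0) Px) ca).
  have [_ /(_ ((1, 0) : W m)) [_ [cD _]]] := CG 1; exact: cD.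
rewrite (HE t x)// in HA.
have cc : (fun p : R * M => (p.1, cfun c1 p.2) : W m) @ (t, x) --> ((t, cfun c1 x) : W m).
  have cs : (fun p : R * M => cfun c1 p.2) @ (t, x) --> cfun c1 x.
    have cf : cfun c1 @ x --> cfun c1 x by exact: chart_fun_continuous.
    exact: (cvg_comp _ _ cvg_snd cf).
  exact: (cvg_pair cvg_fst cs).
have nE : \forall p \near (t, x), A (E (p.1, cfun c1 p.2)).
  exact: (cc _ (cE _ HA)).
have nP : \forall p \near (t, x), P (p.1, cfun c1 p.2).
  exact: (cc _ (open_nbhs_nbhs (conj oP Px))).
have nc : \forall p \near (t, x), cdom c1 p.2.
  have cs : (@snd R M) @ (t, x) --> x by exact: cvg_snd.
  exact: (cs _ (open_nbhs_nbhs (conj (chart_open_dom c1) c1x))).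
apply: filterS3 nE nP nc => -[s y] /= AE Py c1y s01.
by rewrite HE.
Qed.

End smooth_hamiltonians.

(** * Uniform continuity of families on a compact manifold *)

Section compact_families.
Context {R : realType} {M : metricType R}.

(** One modulus for all times: functions are compared below at points that move with [t], and this
    form of continuity passes to uniform limits. *)
Definition ucontinuous_family (Y : pseudoMetricType R) (K : R -> M -> Y) :=
  forall e : R, 0 < e -> exists2 d : R, 0 < d & forall t s x y,
    t \in `[0, 1] -> s \in `[0, 1] -> `|t - s| < d -> ball x d y ->
    ball (K t x) e (K s y).

(** Compactness of [[0, 1] * M] in its near-covering form, applied to radii [d] tending to 0 from
    the right: a common [d] exists as soon as all small [d] work near each point. *)
Lemma jointly_continuous_ucontinuous (Y : pseudoMetricType R)
    (K : R -> M -> Y) :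
  compact [set: M] -> jointly_continuous K -> ucontinuous_family K.
Proof.
move=> cM cK e e0.
have cC : compact ((`[0, 1]%classic : set R) `*` [set: M]).
  by apply: compact_setX => //; exact: segment_compact.
pose P (d : R) (p : R * M) := p.1 \in `[0, 1] -> forall s y, s \in `[0, 1] ->
  `|p.1 - s| < d -> ball p.2 d y -> ball (K p.1 p.2) e (K s y).
have /compact_near_coveringP cov := cC.
suff [d d0 Hd] : exists2 d : R, 0 < d & (`[0, 1]%classic : set R) `*` [set: M] `<=` P d.
  by exists d => // t s x y t01 s01 ts xy; exact: (Hd (t, x)).
have : \forall d \near (0 : R)^'+, (`[0, 1]%classic : set R) `*` [set: M] `<=` P d.
  apply: (cov _ _ (fun d => P d)) => -[t x] [/= t01 _].
  have e20 : 0 < e / 2 by rewrite divr_gt0.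
  have := cK t x _ t01 (nbhsx_ballx (K t x) _ e20).
  move=> /nbhs_ballP[r /= r0 Hr].
  have r20 : 0 < r / 2 by rewrite divr_gt0.
  exists ([set p : R * M | ball (t, x) (r / 2) p], [set d : R | d <= r / 2]) => /=.
    split; first exact: (nbhsx_ballx (t, x) _ r20).
    exact: nbhs_right_le.
  move=> [[u z] d] [/= [utr zxr] dr] u01 s y s01 usd zy /=.
  have Kuz : ball (K t x) (e / 2) (K u z).
    by apply: (Hr (u, z)) => //; split => /=; [apply: le_ball utr|apply: le_ball zxr];
      rewrite ler_pdivrMr// ler_pMr// ler1n.
  have Ksy : ball (K t x) (e / 2) (K s y).
    apply: (Hr (s, y)) => //; split => /=.
      rewrite [r]splitr; apply: (ball_triangle utr).
      exact: lt_le_trans usd dr.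
    rewrite [r]splitr; apply: (ball_triangle zxr).
    exact: le_ball dr _ zy.
  by rewrite [e]splitr; exact: (ball_triangle (ball_sym Kuz) Ksy).
move=> H; have [d [d0 Hd]] := filter_ex (filterI (nbhs_right_gt (0 : R)) H).
by exists d.
Qed.

Lemma ucontinuous_jointly_continuous (Y : pseudoMetricType R)
    (K : R -> M -> Y) : ucontinuous_family K -> jointly_continuous K.
Proof.
move=> uK t x A t01 /nbhs_ballP[e /= e0 He].
have [d d0 Hd] := uK e e0.
apply/nbhs_ballP; exists d => // -[s y] [/= ts xy] s01.
exact: He (Hd _ _ _ _ t01 s01 ts xy).
Qed.

End compact_families.

(** * The norm of a Hamiltonian at a fixed time *)

Section hnorm_theory.
Context {R : realType} {M : pointedMetricType R}.
Context (mu : {measure set (g_sigma_algebraType (@open M)) -> \bar R}).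
Hypothesis cM : compact [set: M].

Definition osc (f : M -> R) := sup (range f) - inf (range f).
Definition mean (f : M -> R) := (fine (mu [set: M]))^-1 * fine (\int[mu]_x (f x)%:E)%E.

Lemma continuous_bounded (f : M -> R) : continuous f ->
  exists B, forall x, `|f x| <= B.
Proof.
move=> cf; have : compact (range f).
  by apply: continuous_compact => //; exact: continuous_subspaceT.
move=> /compact_bounded[B [_ HB]]; exists (B + 1) => x.
by apply: (HB (B + 1)); [rewrite ltrDl|exists x].
Qed.

Lemma osc_ub (f : M -> R) x y : continuous f -> f x - f y <= osc f.
Proof.
move=> /continuous_bounded[B HB]; apply: lerB.
- apply: ub_le_sup; last by exists x.
  by exists B => _ [z _ <-]; rewrite (le_trans (ler_norm _)).
- apply: ge_inf; last by exists y.
  exists (- B) => _ [z _ <-]; rewrite lerNl (le_trans _ (HB z))//.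
  by rewrite -normrN ler_norm.
Qed.

Lemma osc_le (f : M -> R) B : (forall x y, f x - f y <= B) -> osc f <= B.
Proof.
move=> fB; rewrite lerBlDr.
apply: ge_sup; first by exists (f point), point.
move=> _ [x _ <-]; rewrite -lerBlDl; apply: lb_le_inf.
  by exists (f point), point.
by move=> _ [y _ <-]; rewrite lerBlDl -lerBlDr.
Qed.

Lemma osc_ge0 (f : M -> R) : continuous f -> 0 <= osc f.
Proof. by move=> cf; have := osc_ub point point cf; rewrite subrr. Qed.

Lemma continuous_measurable (f : M -> R) : continuous f ->
  measurable_fun [set: g_sigma_algebraType (@open M)] f.
Proof.
move=> /continuousP cf.
apply: (measurability _ (RGenOpens.measurableE R)) => _ [_ [a [b ->] <-]].
rewrite setTI; apply: sub_sigma_algebra; apply: cf; exact: interval_open.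
Qed.

Lemma continuous_integrable (f : M -> R) : fine (mu [set: M]) != 0 ->
  continuous f -> mu.-integrable [set: g_sigma_algebraType (@open M)] (EFin \o f).
Proof.
move=> mu0 cf; apply: measurable_bounded_integrable => //.
- by move: mu0; case: (mu [set: M]) => [r| |] //=; rewrite ?ltry ?eqxx.
- exact: continuous_measurable.
- have [B HB] := continuous_bounded cf.
  exists B; split; first exact: num_real.
  by move=> y By x _; exact: le_trans (HB x) (ltW By).
Qed.

(** The value 0 of [fine] stands for mass zero or infinite mass; the inverse of 0 being 0, the mean
    vanishes. The estimates on [mean] treat this case apart and have finite positive mass in the
    other. *)
Lemma mean_degenerate f : fine (mu [set: M]) = 0 -> mean f = 0.
Proof. by move=> mu0; rewrite /mean mu0 invr0 mul0r. Qed.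

Lemma meanD (f g : M -> R) : continuous f -> continuous g ->
  mean (fun x => f x + g x) = mean f + mean g.
Proof.
move=> cf cg; have [mu0|mu0] := eqVneq (fine (mu [set: M])) 0.
  by rewrite !mean_degenerate// addr0.
rewrite /mean -mulrDr; congr (_ * _).
by apply: RintegralD => //; exact: continuous_integrable.
Qed.

Lemma meanZ (c : R) (f : M -> R) : continuous f ->
  mean (fun x => c * f x) = c * mean f.
Proof.
move=> cf; have [mu0|mu0] := eqVneq (fine (mu [set: M])) 0.
  by rewrite !mean_degenerate// mulr0.
rewrite /mean mulrCA; congr (_ * _).
by apply: RintegralZl => //; exact: continuous_integrable.
Qed.

Lemma mean_cst (c : R) : fine (mu [set: M]) != 0 -> mean (fun=> c) = c.
Proof.
move=> mu0; rewrite /mean -[fine _ in X in _ * X]/(Rintegral mu setT (cst c)).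
by rewrite Rintegral_cst// mulrCA mulVf// mulr1.
Qed.

Lemma mean_le (f : M -> R) B : continuous f -> (forall x, `|f x| <= B) ->
  `|mean f| <= B.
Proof.
move=> cf fB; have B0 : 0 <= B by exact: le_trans (fB point).
have [mu0|mu0] := eqVneq (fine (mu [set: M])) 0.
  by rewrite mean_degenerate// normr0.
have m0 : 0 < fine (mu [set: M]) by rewrite lt_neqAle eq_sym mu0 fine_ge0.
rewrite /mean normrM ger0_norm ?invr_ge0 ?(ltW m0)// ler_pdivrMl//.
have fi := continuous_integrable mu0 cf.
have ai : mu.-integrable [set: g_sigma_algebraType (@open M)] (EFin \o (fun x => `|f x|)).
  apply: continuous_integrable => // x.
  by apply: (@continuous_comp _ _ _ f (fun y : R => `|y|));
    [exact: cf|exact: norm_continuous].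
have ci : mu.-integrable [set: g_sigma_algebraType (@open M)] (EFin \o (cst B)).
  by apply: continuous_integrable => // x; exact: cst_continuous.
apply: (le_trans (le_normr_Rintegral measurableT fi)).
apply: (le_trans (le_Rintegral measurableT ai ci _)) => //.
by rewrite Rintegral_cst// mulrC.
Qed.

Lemma hnormE f : hnorm mu f = osc f + `|mean f|. Proof. by []. Qed.

Lemma hnorm_ge0 f : continuous f -> 0 <= hnorm mu f.
Proof. by move=> cf; rewrite hnormE addr_ge0// osc_ge0. Qed.

Lemma hnormD (f g : M -> R) : continuous f -> continuous g ->
  hnorm mu (fun x => f x + g x) <= hnorm mu f + hnorm mu g.
Proof.
move=> cf cg; rewrite !hnormE meanD// addrACA; apply: lerD; last exact: ler_normD.
apply: osc_le => x y; have := osc_ub x y cf; have := osc_ub x y cg; lra.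
Qed.

(** The oscillation contributes [2 * B] and the mean [B]; this 3 reappears in every passage from the
    sup norm to [hnorm]. *)
Lemma hnorm_le (f : M -> R) B : continuous f -> (forall x, `|f x| <= B) ->
  hnorm mu f <= 3 * B.
Proof.
move=> cf fB; rewrite hnormE; have := mean_le cf fB.
suff : osc f <= 2 * B by lra.
apply: osc_le => x y; have := fB x; have := fB y.
rewrite !ler_norml => /andP[? ?] /andP[? ?]; lra.
Qed.

Lemma hnormZ (c : R) (f : M -> R) : continuous f ->
  hnorm mu (fun x => c * f x) <= `|c| * hnorm mu f.
Proof.
move=> cf; rewrite !hnormE meanZ// mulrDr normrM lerD2r.
apply: osc_le => x y; rewrite -mulrBr.
have [c0|c0] := leP 0 c.
  by rewrite ger0_norm// ler_wpM2l// osc_ub.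
by rewrite ltr0_norm// -mulrNN opprB ler_wpM2l ?osc_ub// oppr_ge0 ltW.
Qed.

(* The mean of f lies between its extreme values, so that hnorm f dominates the
   sup norm of f unless mu gives M no finite positive mass; in that case mean
   is identically 0. *)
Lemma hnorm_comp (f : M -> R) (phi : M -> M) : continuous f -> continuous phi ->
  hnorm mu (f \o phi) <= 2 * hnorm mu f.
Proof.
move=> cf cphi.
have cfp : continuous (f \o phi) 
  by move=> x; apply: continuous_comp; [exact: cphi|exact: cf].
have ofp : osc (f \o phi) <= osc f by apply: osc_le => x y;
  exact: (osc_ub (phi x) (phi y) cf).
rewrite [leLHS]hnormE; suff : `|mean (f \o phi)| <= hnorm mu f.
  by rewrite hnormE; have := normr_ge0 (mean f); lra.
have [mu0|mu0] := eqVneq (fine (mu [set: M])) 0.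
  by rewrite mean_degenerate// normr0 hnorm_ge0.
apply: mean_le => // x; rewrite /= hnormE.
move: (phi x) => {}x.
have : `|mean f - f x| <= osc f.
  rewrite -{1}(mean_cst (f x) mu0).
  have E : - mean (fun=> f x) = mean (fun=> -1 * f x).
    by rewrite meanZ ?mulN1r// => y; exact: cst_continuous.
  rewrite E -meanD//; first last.
  - by move=> y; exact: cst_continuous.
  - apply: mean_le; first by move=> y; apply: cvgD; [exact: cf|exact: cvg_cst].
    move=> y; rewrite mulN1r ler_norml lerNl opprB !osc_ub//.
have := ler_normD (mean f) (f x - mean f); rewrite addrCA subrr addr0 (distrC (f x)).
lra.
Qed.

End hnorm_theory.

(** * Simple functions of time and strong measurability *)

Section simple_paths.
Context {R : realType}.

(** All sets [B] are tested, so [T] may be a space of functions without a sigma-algebra, and any map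
    may be applied to the values. *)
Definition simple_path (T : Type) (s : R -> T) :=
  finite_set (s @` `[0, 1]) /\ forall B : set T, measurable (`[0, 1] `&` s @^-1` B).

Lemma simple_path_points (T : Type) (s : R -> T) :
  finite_set (s @` `[0, 1]) ->
  (forall x, measurable (`[0, 1] `&` s @^-1` [set x])) -> simple_path s.
Proof.
move=> fs ms; split => // B.
have -> : `[0, 1] `&` s @^-1` B =
    \bigcup_(x in s @` `[0, 1] `&` B) (`[0, 1] `&` s @^-1` [set x]).
  apply/seteqP; split => [t [t01 Bst]|t [x [_ Bx] [t01 /= sx]]].
    by exists (s t) => //; split => //; exists t.
  by split => //=; rewrite sx.
by apply: fin_bigcup_measurable => //; exact: finite_setIl.
Qed.

Lemma simple_path_comp (T U : Type) (g : T -> U) (s : R -> T) :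
  simple_path s -> simple_path (g \o s).
Proof.
move=> [fs ms]; split; first by rewrite -image_comp; exact: finite_image.
by move=> B; exact: (ms (g @^-1` B)).
Qed.

Lemma simple_path_pair (T U : Type) (s : R -> T) (u : R -> U) :
  simple_path s -> simple_path u -> simple_path (fun t => (s t, u t)).
Proof.
move=> [fs ms] [fu mu]; apply: simple_path_points.
  apply: (@sub_finite_set _ _ ((s @` `[0, 1]) `*` (u @` `[0, 1]))).
    by move=> _ [t t01 <-]; split; exists t.
  exact: finite_setX.
move=> [x y].
rewrite (_ : _ `&` _ = (`[0, 1] `&` s @^-1` [set x]) `&` (`[0, 1] `&` u @^-1` [set y])).
  exact: measurableI.
apply/seteqP; split => [t [t01 /= [<- <-]]//|t [[t01 /= sx] [_ /= uy]]].
by split => //=; congr (_, _).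
Qed.

Lemma simple_path_reparam (T : Type) (f : R -> T) (s : R) :
  s \in `[0, 1] -> simple_path f -> simple_path (fun t => f (s * t)).
Proof.
move=> s01 [ff mf]; split.
  apply: (@sub_finite_set _ _ (f @` `[0, 1])) => // _ [t t01 <-].
  by exists (s * t) => //; exact: mulr_itv01.
move=> B.
have -> : `[0, 1] `&` (fun t => f (s * t)) @^-1` B =
    `[0, 1] `&` ( *%R s) @^-1` (`[0, 1] `&` f @^-1` B).
  apply/seteqP; split => [t [t01 fB]|t [t01 [_ fB]]]; split => //.
  by split => //; exact: mulr_itv01.
have := @mulrl_measurable R setT s measurableT _ (mf B).
rewrite setTI => m1.
by apply: measurableI => //; exact: m1.
Qed.

Lemma simple_path_measurable (f : R -> R) :
  simple_path f -> measurable_fun (`[0, 1]%classic : set R) f.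
Proof. by move=> [_ mf] _ B _; exact: mf. Qed.

Import HBNNSimple.

(** The canonical simple approximations of the identity discretise time. They increase to [t] from
    below, hence stay in [[0, 1]], where the families are controlled. *)
Lemma simple_times : exists th : nat -> R -> R, [/\ forall k, simple_path (th k),
  forall k (t : R), t \in `[0, 1] -> th k t \in `[0, 1] &
  forall t : R, t \in `[0, 1] -> th ^~ t @ \oo --> t].
Proof.
have mD : measurable (`[0, 1]%classic : set R) by [].
have mid : measurable_fun (`[0, 1]%classic : set R) (EFin \o @id R).
  exact: measurableT_comp.
have id0 (t : R) : (`[0, 1]%classic : set R) t -> (0 <= (EFin \o id) t)%E.
  by rewrite /= in_itv /= lee_fin => /andP[].
pose th := nnsfun_approx mD mid.
have cth (t : R) : t \in `[0, 1] -> (fun k => th k t) @ \oo --> t.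
  move=> t01; have := cvg_nnsfun_approx mD mid id0 t01.
  by move=> /fine_cvgP[_]; rewrite /comp /=; exact.
exists (fun k => th k : R -> R); split => //.
- move=> k; apply: simple_path_points.
    apply: (@sub_finite_set _ _ (range (th k))) => [_ [t _ <-]|]; first by exists t.
    exact: fimfunP.
  by move=> x; apply: measurableI => //; exact: measurable_sfunP.
- move=> k t t01; rewrite in_itv /=; apply/andP; split; first exact: fun_ge0.
  apply: (@le_trans _ _ t); last by move: t01; rewrite in_itv => /andP[].
  have nd : nondecreasing_seq (fun k => th k t).
    by move=> i j ij; have /lefP := nd_nnsfun_approx mD mid ij; exact.
  by have := nondecreasing_cvgn_le nd (cvgP _ (cth t t01)) k;
    rewrite (cvg_lim _ (cth t t01)).
Qed.

End simple_paths.

Section strong_measurability.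
Context {R : realType} {M : pointedMetricType R}.
Context (mu : {measure set (g_sigma_algebraType (@open M)) -> \bar R}).
Hypothesis cM : compact [set: M].

Lemma cvg_uniformP (F : set_system (M -> R)) (f : M -> R) : Filter F ->
  {uniform, F --> f} <->
  forall e : R, 0 < e -> \forall g \near F, forall x, `|f x - g x| < e.
Proof.
move=> FF; split.
  move=> H e e0; apply: H; apply/uniform_nbhs.
  exists [set p : R * R | ball p.1 e p.2]; split => //=.
    by rewrite -entourage_ballE; exists e.
  by move=> g /= Hg x; exact: Hg.
move=> H P /uniform_nbhs[E [/= entE EP]].
move: entE; rewrite -entourage_ballE => -[e /= e0 He].
apply: filterS (H e e0) => g Hg; apply: EP => x _.
exact: (He (f x, g x) (Hg x)).
Qed.

(** [L1C0] is this together with finiteness of [hnorm1]; the measurable part is separated because it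
    is preserved by composition and change of speed without any estimate. *)
Definition strongly_measurable (H : R -> M -> R) :=
  (forall t, t \in `[0, 1] -> continuous (H t)) /\
  exists s : nat -> R -> M -> R, [/\ forall k, simple_path (s k),
    forall k t, t \in `[0, 1] -> continuous (s k t) &
    forall t e, t \in `[0, 1] -> 0 < e ->
      \forall k \near \oo, forall x, `|H t x - s k t x| < e].

Lemma L1C0P (H : R -> M -> R) : L1C0 mu H <->
  strongly_measurable H /\ (hnorm1 mu H < +oo)%E.
Proof.
split.
  move=> [cH [s [fs ms cs sH]] Hoo]; split => //; split => //.
  exists s; split => //.
    by move=> k; apply: simple_path_points => // f; exact: ms.
  by move=> t e t01 e0; have /cvg_uniformP := sH t t01; move=> /(_ _ e0).
move=> [[cH [s [ss cs sH]]] Hoo]; split => //.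
exists s; split => //; try by move=> k; case: (ss k).
by move=> t t01; apply/cvg_uniformP => e e0; exact: sH.
Qed.

Lemma strongly_measurable_lin (a b : R) (H F : R -> M -> R) : strongly_measurable H ->
  strongly_measurable F ->
  strongly_measurable (fun t x => a * H t x + b * F t x).
Proof.
have clin (f g : M -> R) : continuous f -> continuous g ->
    continuous (fun x => a * f x + b * g x).
  by move=> cf cg x; apply: cvgD; apply: cvgM;
    [exact: cvg_cst|exact: cf|exact: cvg_cst|exact: cg].
move=> [cH [s [ss cs sH]]] [cF [u [su cu uF]]]; split.
  by move=> t t01; apply: clin; [exact: cH|exact: cF].
exists (fun k t x => a * s k t x + b * u k t x); split.
- move=> k; exact: (simple_path_comp (fun p x => a * p.1 x + b * p.2 x)
    (simple_path_pair (ss k) (su k))).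
- by move=> k t t01; apply: clin; [exact: cs|exact: cu].
- move=> t e t01 e0.
  pose C := `|a| + `|b| + 1.
  have C0 : 0 < C by rewrite ltr_wpDl// addr_ge0.
  have eC : 0 < e / C by rewrite divr_gt0.
  have H1 := sH t _ t01 eC; have H2 := uF t _ t01 eC.
  near=> k => x.
  have h1 : `|H t x - s k t x| < e / C by move: x; near: k.
  have h2 : `|F t x - u k t x| < e / C by move: x {h1}; near: k.
  rewrite [X in `|X|](_ : _ = a * (H t x - s k t x) + b * (F t x - u k t x));
    last by ring.
  rewrite (le_lt_trans (ler_normD _ _))// !normrM.
  apply: (@le_lt_trans _ _ ((`|a| + `|b|) * (e / C))).
    by rewrite mulrDl lerD// ler_wpM2l// ltW.
  by rewrite mulrCA gtr_pMr// ltr_pdivrMr// mul1r /C ltrDl.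
Unshelve. all: by end_near. Qed.

Lemma ucontinuous_cst (Y : pseudoMetricType R) (f : M -> Y) :
  continuous f -> ucontinuous_family (fun=> f : M -> Y).
Proof.
move=> cf; apply: jointly_continuous_ucontinuous => // t x A _ fA.
have cs : (@snd R M) @ (t, x) --> x by exact: cvg_snd.
have : \forall p \near (t, x), A (f p.2) by exact: (cs _ (cf x A fA)).
by apply: filterS => p.
Qed.

Lemma ucontinuous_continuous (Y : pseudoMetricType R) (K : R -> M -> Y) t :
  t \in `[0, 1] -> ucontinuous_family K -> continuous (K t).
Proof.
move=> t01 uK x A /nbhs_ballP[e /= e0 He].
have [d d0 Hd] := uK e e0; apply/nbhs_ballP; exists d => // y xy.
by apply: He; apply: Hd => //; rewrite subrr normr0.
Qed.

(** The time of [phi] is discretised as well, so that the approximants remain simple. The error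
    splits into the uniform continuity of the fixed function [H t] and the uniform distance from
    [s k t] to [H t]. *)
Lemma strongly_measurable_comp (H : R -> M -> R) (phi : R -> M -> M) :
  strongly_measurable H -> ucontinuous_family phi -> strongly_measurable (fun t x =>
    H t (phi t x)).
Proof.
move=> [cH [s [ss cs sH]]] uphi.
have cphi t : t \in `[0, 1] -> continuous (phi t).
  by move=> t01; exact: ucontinuous_continuous.
have [th [sth th01 cth]] := simple_times (R := R).
split.
  by move=> t t01 x; apply: continuous_comp; [exact: cphi|exact: cH].
exists (fun k t x => s k t (phi (th k t) x)); split.
- move=> k; exact: (simple_path_comp (fun p x => p.1 (phi p.2 x))
    (simple_path_pair (ss k) (sth k))).
- move=> k t t01 x; apply: continuous_comp; last exact: cs.
  exact: cphi (th01 _ _ t01) _.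
- move=> t e t01 e0; have e20 : 0 < e / 2 by rewrite divr_gt0.
  have [d d0 Hd] := ucontinuous_cst (cH t t01) e20.
  have [r r0 Hr] := uphi d d0.
  have H1 := sH t _ t01 e20.
  have H2 : \forall k \near \oo, `|t - th k t| < r 
    by have /cvgrPdist_lt := cth t t01; apply.
  near=> k => x; rewrite [e]splitr.
  rewrite -(subrKA (H t (phi (th k t) x))) (le_lt_trans (ler_normD _ _))// ltrD//.
    apply: (Hd t t) => //; first by rewrite subrr normr0.
    apply: Hr => //; [exact: th01|by near: k|exact: ballxx].
  by move: (phi _ x) => {x}; near: k.
Unshelve. all: by end_near. Qed.

Lemma strongly_measurable_time_change (H : R -> M -> R) (s : R) : s \in `[0, 1] ->
  strongly_measurable H -> strongly_measurable (fun t => H (s * t)).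
Proof.
move=> s01 [cH [u [su cu uH]]]; split; first by move=> t t01; apply: cH;
  exact: mulr_itv01.
exists (fun k t => u k (s * t)); split.
- by move=> k; exact: simple_path_reparam.
- by move=> k t t01; apply: cu; exact: mulr_itv01.
- by move=> t e t01 e0; apply: uH => //; exact: mulr_itv01.
Qed.

Lemma strongly_measurable_reparam (H : R -> M -> R) (s : R) : s \in `[0, 1] ->
  strongly_measurable H -> strongly_measurable (fun t x => s * H (s * t) x).
Proof.
move=> s01 /(strongly_measurable_time_change s01) sH;
  have := strongly_measurable_lin s 0 sH sH.
rewrite (_ : (fun _ _ => _ + _) = (fun t x => s * H (s * t) x))//.
by apply/funext => t; apply/funext => x; rewrite mul0r addr0.
Qed.

Lemma strongly_measurable_ucontinuous (H : R -> M -> R) : ucontinuous_family H ->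
  strongly_measurable H.
Proof.
move=> uH; have [th [sth th01 cth]] := simple_times (R := R).
split; first by move=> t t01; exact: ucontinuous_continuous.
exists (fun k t => H (th k t)); split.
- by move=> k; exact: simple_path_comp.
- by move=> k t t01; apply: ucontinuous_continuous => //; exact: th01.
- move=> t e t01 e0; have [d d0 Hd] := uH e e0.
  have H2 : \forall k \near \oo, `|t - th k t| < d 
    by have /cvgrPdist_lt := cth t t01; apply.
  near=> k => x; apply: Hd => //; [exact: th01|by near: k|exact: ballxx].
Unshelve. all: by end_near. Qed.

(** [hnorm mu] is Lipschitz with constant 3 for the sup norm, so the function is a pointwise limit
    of the simple functions [hnorm mu (s k t)]; hence the [e / 3] below. *)
Lemma strongly_measurable_measurable (H : R -> M -> R) : strongly_measurable H ->
  measurable_fun (`[0, 1]%classic : set R) (fun t => (hnorm mu (H t))%:E).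
Proof.
move=> [cH [s [ss cs sH]]].
apply: (@emeasurable_fun_cvg _ _ _ _ (fun k t => (hnorm mu (s k t))%:E)).
  move=> k; apply/measurable_EFinP; apply: simple_path_measurable.
  exact: (simple_path_comp (hnorm mu) (ss k)).
move=> t t01; apply: cvg_EFin; first by near=> k.
apply/cvgrPdist_le => e e0.
have e30 : 0 < e / 3 by rewrite divr_gt0.
have H1 := sH t _ t01 e30; near=> k.
have h1 x : `|H t x - s k t x| < e / 3 by move: x; near: k.
have cD (f g : M -> R) : continuous f -> continuous g -> continuous (fun x => f x - g x).
  by move=> cf cg x; apply: cvgB; [exact: cf|exact: cg].
have tri (f g : M -> R) : continuous f -> continuous g ->
    (forall x, `|f x - g x| < e / 3) -> hnorm mu f <= hnorm mu g + e.
  move=> cf cg fg.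
  have := hnormD mu cM cg (cD _ _ cf cg).
  have := hnorm_le mu cM (cD _ _ cf cg) (fun x => ltW (fg x)).
  rewrite mulrCA divff// mulr1.
  rewrite (_ : (fun x => g x + (f x - g x)) = f); first lra.
  by apply/funext => x; rewrite addrC subrK.
have a1 := tri _ _ (cH t t01) (cs k t t01) h1.
have h2 x : `|s k t x - H t x| < e / 3 by rewrite distrC.
have a2 := tri _ _ (cs k t t01) (cH t t01) h2.
rewrite /= ler_norml; lra.
Unshelve. all: by end_near. Qed.

End strong_measurability.

(** * Linear change of time in Lebesgue integrals *)

Section lebesgue_scaling.
Context {R : realType}.

(** The image of Lebesgue measure under multiplication by [s], times [s], has the right values on
    half-open intervals, and these determine Lebesgue measure. *)
Lemma lebesgue_measure_scale (s : R) (A : set R) : 0 < s -> measurable A ->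
  lebesgue_measure A = (s%:E * lebesgue_measure (( *%R s) @^-1` A))%E.
Proof.
move=> s0 mA.
have mphi : measurable_fun [set: measurableTypeR R] ( *%R s : _ -> measurableTypeR R).
  exact: mulrl_measurable.
pose m := mscale (NngNum (ltW s0))
  (measure_function_pushforward__canonical__measure_function_Measure lebesgue_measure
    mphi).
rewrite (@lebesgue_measure_unique R m)// => _ [[a b] /= _ <-].
rewrite /m /mscale /= /pushforward.
rewrite [X in _ = (_ * _ X)%E](_ : _ = `](a / s), (b / s)]%classic); last first.
  apply/seteqP; split => x /=; rewrite !in_itv /= ltr_pdivrMr// ler_pdivlMr//;
    by rewrite (mulrC x).
rewrite !lebesgue_measure_itv /= !lte_fin ltr_pM2r ?invr_gt0//.
case: ifPn => _; last by rewrite mule0.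
by rewrite -!EFinB -EFinM -mulrBl mulrCA divff ?mulr1// gt_eqF.
Qed.

(** For positive [s], substitution turns the left side into the integral of [h] over [[0, s]]; for
    [s = 0] it is 0. *)
Lemma integral_reparam_le (s : R) (h : R -> \bar R) : s \in `[0, 1] ->
  measurable_fun (`[0, 1]%classic : set R) h ->
  (forall t : R, t \in `[0, 1] -> (0 <= h t)%E) ->
  (\int[lebesgue_measure]_(t in `[0%R, 1%R]) (s%:E * h (s * t)%R) <=
   \int[lebesgue_measure]_(t in `[0%R, 1%R]) h t)%E.
Proof.
rewrite in_itv /= => /andP[s0 s1] mh h0.
have h0' t : (`[0, 1]%classic : set R) t -> (0 <= h t)%E by exact: h0.
have [->|sn0] := eqVneq s 0.
  under eq_integral do rewrite mul0e.
  by rewrite integral0 integral_ge0.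
have {}s0 : 0 < s by rewrite lt_neqAle eq_sym sn0.
have mphi : measurable_fun [set: measurableTypeR R] ( *%R s : _ -> measurableTypeR R).
  exact: mulrl_measurable.
pose m := mscale (NngNum (ltW s0))
  (measure_function_pushforward__canonical__measure_function_Measure lebesgue_measure
    mphi).
have ss1 : (`[0, s]%classic : set R) `<=` `[0, 1].
  by move=> t /=; rewrite !in_itv /= => /andP[-> /le_trans]; apply.
have hs : measurable_fun (`[0, s]%classic : set R) h by exact: measurable_funS mh.
have hs0 t : (`[0, s]%classic : set R) t -> (0 <= h t)%E by move=> /ss1 /h0'.
have E : (\int[lebesgue_measure]_(t in `[0%R, s]) h t =
    \int[m]_(t in `[0%R, s]) h t)%E.
  apply: eq_measure_integral => A mA _; exact: lebesgue_measure_scale.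
apply: (@le_trans _ _ (\int[lebesgue_measure]_(t in `[0%R, s]) h t)%E); last first.
  exact: ge0_subset_integral.
rewrite E ge0_integral_mscale//= ge0_integral_pushforward//=; last first.
  by move=> y /set_mem; exact: hs0.
have -> : ( *%R s) @^-1` `[0, s]%classic = `[0, 1]%classic.
  apply/seteqP; split => x /=; by rewrite !in_itv /= pmulr_rge0// ger_pMr.
have s0' := ltW s0.
have s01 : s \in `[0, 1] by rewrite in_itv /= s0' s1.
rewrite ge0_integralZl_EFin//.
- by move=> t /= t01; apply: h0; exact: mulr_itv01.
- apply: (measurable_comp (F := (`[0, 1]%classic : set R)) (f := h)) => //.
  by move=> _ [t /= t01 <-]; exact: mulr_itv01.
Qed.

End lebesgue_scaling.

(** * Estimates for the integrated norm *)

Section hnorm1_theory.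
Context {R : realType} {M : pointedMetricType R}.
Context (mu : {measure set (g_sigma_algebraType (@open M)) -> \bar R}).
Hypothesis cM : compact [set: M].

(** The common source of the estimates for sums, opposites and composites, with coefficients
    [(1, 1)], [(1, 0)] and [(2, 0)]; strong measurability makes the integrands measurable. *)
Lemma hnorm1_triangle (a b : R) (H F G : R -> M -> R) : 0 <= a -> 0 <= b ->
  strongly_measurable H -> strongly_measurable F -> strongly_measurable G ->
  (forall t, t \in `[0, 1] ->
    hnorm mu (H t) <= a * hnorm mu (F t) + b * hnorm mu (G t)) ->
  (hnorm1 mu H <= a%:E * hnorm1 mu F + b%:E * hnorm1 mu G)%E.
Proof.
move=> a0 b0 sH sF sG HFG; rewrite /hnorm1.
have n0 K t : strongly_measurable K -> t \in `[0, 1] -> (0 <= (hnorm mu (K t))%:E)%E.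
  by move=> [cK _] t01; rewrite lee_fin hnorm_ge0//; exact: cK.
have mI : measurable (`[0, 1]%classic : set R) by [].
have mn K (k : R) : strongly_measurable K ->
    measurable_fun (`[0, 1]%classic : set R) (fun t => k%:E * (hnorm mu (K t))%:E)%E.
  by move=> sK; apply: measurable_funeM; exact: strongly_measurable_measurable.
rewrite -!ge0_integralZl_EFin//; try exact: strongly_measurable_measurable;
  try (by move=> t t01; exact: n0).
rewrite -ge0_integralD//; try exact: mn;
  try (by move=> t t01; rewrite mule_ge0 ?lee_fin// -?lee_fin; exact: n0).
apply: ge0_le_integral => //.
- by move=> t t01; exact: n0.
- exact: strongly_measurable_measurable.
- by apply: emeasurable_funD; exact: mn.
Qed.

Lemma hnorm1_ge0 (H : R -> M -> R) : strongly_measurable H -> (0 <= hnorm1 mu H)%E.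
Proof.
by move=> [cH _]; apply: integral_ge0 => t t01; rewrite lee_fin hnorm_ge0//; exact: cH.
Qed.

Lemma hnorm1_le (B : R) (H : R -> M -> R) : strongly_measurable H ->
  (forall t x, t \in `[0, 1] -> `|H t x| <= B) -> (hnorm1 mu H <= (3 * B)%:E)%E.
Proof.
move=> sH HB; have [cH _] := sH.
apply: (@le_trans _ _ (\int[lebesgue_measure]_(t in `[0%R, 1%R]) (cst (3 * B)%:E) t)%E).
  apply: ge0_le_integral => //.
  - by move=> t t01; rewrite lee_fin hnorm_ge0//; exact: cH.
  - exact: strongly_measurable_measurable.
  - by move=> t t01; rewrite lee_fin; apply: hnorm_le => //; [exact: cH|move=> x;
    exact: HB].
rewrite integral_cst//= lebesgue_measure_itv /= lte_fin ltr01 oppr0 adde0.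
by rewrite mule1.
Qed.

Lemma hnorm1_comp (H : R -> M -> R) (phi : R -> M -> M) :
  strongly_measurable H -> ucontinuous_family phi ->
  (hnorm1 mu (fun t x => H t (phi t x)) <= 2%:E * hnorm1 mu H)%E.
Proof.
move=> sH uphi; have [cH _] := sH.
have := @hnorm1_triangle 2 0 (fun t x => H t (phi t x)) H H (ler0n _ 2) (lexx 0).
rewrite mul0e adde0; apply => //; first exact: strongly_measurable_comp.
move=> t t01; rewrite mul0r addr0; apply: hnorm_comp => //; first exact: cH.
exact: ucontinuous_continuous.
Qed.

(** The factor [s], taken out of the norm by [hnormZ], is exactly the Jacobian of the change of
    time, so nothing is lost. *)
Lemma hnorm1_reparam (H : R -> M -> R) (s : R) : s \in `[0, 1] -> strongly_measurable H ->
  (hnorm1 mu (fun t x => (s * H (s * t) x)%R) <= hnorm1 mu H)%E.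
Proof.
move=> s01 sH; have [cH _] := sH.
apply: le_trans (integral_reparam_le s01 (strongly_measurable_measurable mu cM sH) _);
  last first.
  by move=> t t01; rewrite lee_fin hnorm_ge0//; exact: cH.
have cHs t : t \in `[0, 1] -> continuous (H (s * t)).
  by move=> t01; apply: cH; exact: mulr_itv01.
apply: ge0_le_integral => //.
- move=> t t01; rewrite lee_fin hnorm_ge0// => x.
  by apply: cvgM; [exact: cvg_cst|exact: cHs].
- exact: (strongly_measurable_measurable mu cM (strongly_measurable_reparam s01 sH)).
- apply: measurable_funeM.
  have := strongly_measurable_measurable mu cM (strongly_measurable_time_change s01 sH).
  exact.
- move=> t t01; rewrite -EFinM lee_fin; apply: le_trans (hnormZ _ _ _ _) _ => //.
    exact: cHs.
  by rewrite ger0_norm//; move: s01; rewrite in_itv => /andP[].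
Qed.
End hnorm1_theory.

(** * Distances between isotopies *)

Section isotopy_distance.
Context {R : realType} {M : pointedMetricType R}.
Hypothesis cM : compact [set: M].

(** Boundedness makes the suprema in [dbar] and [dbar_iso] actual upper bounds; the [sup] of an
    unbounded set is a default value. *)
Lemma mdist_bounded : exists B : R, forall x y : M, mdist x y <= B.
Proof.
have cd : continuous (fun x : M => mdist point x : R).
  move=> x; apply/cvgrPdist_lt => e e0.
  have : \forall y \near x, ball x e y by exact: nbhsx_ballx.
  apply: filterS => y; rewrite ballEmdist /= => xy.
  have h1 := metric_triangle point x y; have h2 := metric_triangle point y x.
  rewrite (metric_sym y x) in h2.
  by rewrite ltr_norml; lra.
have [B HB] := continuous_bounded cM cd.
exists (B + B) => x y; have := metric_triangle x point y.
rewrite (metric_sym x point) => /le_trans; apply.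
by apply: lerD; exact: le_trans (ler_norm _) (HB _).
Qed.

Lemma dbar_ge (f g : homeo M) x :
  mdist (f x) (g x) <= dbar f g /\ mdist (hinv f x) (hinv g x) <= dbar f g.
Proof.
have [B HB] := mdist_bounded.
have ub (h k : M -> M) : has_ubound (range (fun x => mdist (h x) (k x))).
  by exists B => _ [y _ <-].
have le (h k : M -> M) y : mdist (h y) (k y) <= sup (range (fun x => mdist (h x) (k x))).
  by apply: ub_le_sup => //; exists y.
have ge0 (h k : M -> M) : 0 <= sup (range (fun x => mdist (h x) (k x))).
  exact: le_trans (mdist_ge0 _ _) (le h k point).
split; first by rewrite (le_trans (le f g x))// lerDl.
by rewrite (le_trans (le (hinv f) (hinv g) x))// lerDr.
Qed.

Lemma dbar_le (f g : homeo M) e :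
  (forall x, mdist (f x) (g x) <= e /\ mdist (hinv f x) (hinv g x) <= e) ->
  dbar f g <= e + e.
Proof.
move=> H; apply: lerD; apply: ge_sup;
  try (by exists (mdist (f point) (g point)), point);
  try (by exists (mdist (hinv f point) (hinv g point)), point).
- by move=> _ [x _ <-]; case: (H x).
- by move=> _ [x _ <-]; case: (H x).
Qed.

(** Pointwise substitute for [dbar_iso], equivalent to it up to a factor 2 because [dbar] adds two
    suprema. Inverses are included, so that their uniform continuity passes to limits. *)
Definition close (e : R) (Phi Psi : R -> homeo M) := forall t x, t \in `[0, 1] ->
  mdist (Phi t x) (Psi t x) < e /\ mdist (hinv (Phi t) x) (hinv (Psi t) x) < e.

Lemma dbar_iso_close (Phi Psi : R -> homeo M) e : dbar_iso Phi Psi < e ->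
  close e Phi Psi.
Proof.
move=> He t x t01; have [B HB] := mdist_bounded.
have ub : dbar (Phi t) (Psi t) <= dbar_iso Phi Psi.
  apply: ub_le_sup; last by exists t.
  by exists (B + B) => _ [s _ <-]; exact: dbar_le.
have [h1 h2] := dbar_ge (Phi t) (Psi t) x.
by split; [apply: le_lt_trans h1 _|apply: le_lt_trans h2 _]; exact: le_lt_trans ub He.
Qed.

Lemma close_dbar_iso (Phi Psi : R -> homeo M) e : close e Phi Psi ->
  dbar_iso Phi Psi <= e + e.
Proof.
move=> H; apply: ge_sup.
  exists (dbar (Phi 0) (Psi 0)), 0 => //.
  by rewrite /= in_itv /= lexx ler01.
move=> _ [t t01 <-]; apply: dbar_le => x.
by have [h1 h2] := H t x t01; split; exact: ltW.
Qed.

Lemma dbar_iso_ge0 (Phi Psi : R -> homeo M) : 0 <= dbar_iso Phi Psi.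
Proof.
rewrite leNgt; apply/negP => /dbar_iso_close /(_ 0 point).
rewrite in_itv /= lexx ler01 => /(_ isT)[+ _].
by rewrite ltNge mdist_ge0.
Qed.

Lemma cvg_dbar_isoP (Phi_ : nat -> R -> homeo M) Phi :
  (fun i => dbar_iso (Phi_ i) Phi) @ \oo --> (0 : R) <->
  forall e : R, 0 < e -> \forall i \near \oo, close e (Phi_ i) Phi.
Proof.
split.
  move=> /cvgrPdist_lt H e e0; apply: filterS (H e e0) => i.
  rewrite sub0r normrN => h; apply: dbar_iso_close.
  exact: le_lt_trans (ler_norm _) h.
move=> H; apply/cvgrPdist_lt => e e0.
have e30 : 0 < e / 3 by rewrite divr_gt0.
apply: filterS (H _ e30) => i /close_dbar_iso h.
by rewrite sub0r normrN ger0_norm ?dbar_iso_ge0//; lra.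
Qed.

Lemma closeC e Phi Psi : close e Phi Psi -> close e Psi Phi.
Proof.
move=> H t x t01; have [h1 h2] := H t x t01.
by rewrite (metric_sym (Psi t x)) (metric_sym (hinv (Psi t) x)).
Qed.

Lemma ucontinuous_limit (K : R -> M -> M) :
  (forall e : R, 0 < e -> exists2 F : R -> M -> M, ucontinuous_family F &
    forall t x, t \in `[0, 1] -> mdist (F t x) (K t x) < e) ->
  ucontinuous_family K.
Proof.
move=> H e e0; have e30 : 0 < e / 3 by rewrite divr_gt0.
have [F uF FK] := H _ e30; have [d d0 Hd] := uF _ e30.
exists d => // t s x y t01 s01 ts xy.
have := Hd t s x y t01 s01 ts xy; rewrite !ballEmdist /= => h.
have h1 := FK t x t01; have h2 := FK s y s01.
have a1 := metric_triangle (K t x) (F t x) (K s y).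
have a2 := metric_triangle (F t x) (F s y) (K s y).
by rewrite (metric_sym (K t x) (F t x)) in a1; lra.
Qed.

Lemma ucontinuous_comp (Y : pseudoMetricType R) (F : R -> M -> Y) (G : R -> M -> M) :
  ucontinuous_family F -> ucontinuous_family G ->
  ucontinuous_family (fun t x => F t (G t x)).
Proof.
move=> uF uG e e0; have [d d0 Hd] := uF e e0; have [r r0 Hr] := uG d d0.
exists (Num.min d r) => [|t s x y t01 s01]; first by rewrite lt_min d0.
rewrite lt_min => /andP[td tr] xy.
apply: Hd => //; apply: Hr => //.
by apply: le_ball xy; rewrite ge_min lexx orbT.
Qed.

Lemma ucontinuous_reparam (Y : pseudoMetricType R) (F : R -> M -> Y) (s : R) :
  s \in `[0, 1] -> ucontinuous_family F -> ucontinuous_family (fun t => F (s * t)).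
Proof.
move=> s01 uF e e0; have [d d0 Hd] := uF e e0.
exists d => // t u x y t01 u01 tu xy; apply: Hd => //; try exact: mulr_itv01.
rewrite -mulrBr normrM (le_lt_trans _ tu)// ler_piMl//.
by move: s01; rewrite in_itv /= => /andP[? ?]; rewrite ger0_norm.
Qed.

Definition quotient (Phi Psi : R -> homeo M) (t : R) : homeo M :=
  comp_homeo (inv_homeo (Phi t)) (Psi t).

Definition ucontinuous_isotopy (Phi : R -> homeo M) :=
  ucontinuous_family (fun t => Phi t : M -> M) /\
  ucontinuous_family (fun t => hinv (Phi t)).

Lemma ucontinuous_quotient (Phi Psi : R -> homeo M) :
  ucontinuous_isotopy Phi -> ucontinuous_isotopy Psi ->
  ucontinuous_isotopy (quotient Phi Psi).
Proof.
move=> [uF uFi] [uG uGi]; split.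
  exact: (ucontinuous_comp uFi uG).
exact: (ucontinuous_comp uGi uF).
Qed.

(** The outer map is replaced first, at the cost of its distance, then the inner one, at the cost of
    the modulus of the outer limit map. In the quotient and in its inverse the outer maps are
    inverses, so the moduli of [hinv (Phi t)] and [hinv (Psi t)] are used, never those of [Phi'] and
    [Psi']. *)
Lemma close_quotient (Phi Psi : R -> homeo M) :
  ucontinuous_isotopy Phi -> ucontinuous_isotopy Psi ->
  forall e : R, 0 < e -> exists2 d : R, 0 < d & forall Phi' Psi',
    close d Phi' Phi -> close d Psi' Psi ->
    close e (quotient Phi' Psi') (quotient Phi Psi).
Proof.
move=> [_ uFi] [_ uGi] e e0; have e20 : 0 < e / 2 by rewrite divr_gt0.
have [d d0 Hd] := uFi _ e20; have [r r0 Hr] := uGi _ e20.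
exists (Num.min (e / 2) (Num.min d r)); first by rewrite !lt_min e20 d0.
move=> Phi' Psi' cF cG t x t01 /=; split.
- have [+ _] := cG t x t01; rewrite !lt_min => /and3P[_ h _].
  have [_ +] := cF t (Psi' t x) t01; rewrite !lt_min => /and3P[h' _ _].
  have := Hd t t (Psi' t x) (Psi t x) t01 t01.
  rewrite subrr normr0 !ballEmdist /= => /(_ d0 h) h2.
  have := metric_triangle (hinv (Phi' t) (Psi' t x)) (hinv (Phi t) (Psi' t x))
    (hinv (Phi t) (Psi t x)); lra.
- have [+ _] := cF t x t01; rewrite !lt_min => /and3P[_ _ h].
  have [_ +] := cG t (Phi' t x) t01; rewrite !lt_min => /and3P[h' _ _].
  have := Hr t t (Phi' t x) (Phi t x) t01 t01.
  rewrite subrr normr0 !ballEmdist /= => /(_ r0 h) h2.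
  have := metric_triangle (hinv (Psi' t) (Phi' t x)) (hinv (Psi t) (Phi' t x))
    (hinv (Psi t) (Phi t x)); lra.
Qed.

Lemma close_reparam (Phi : R -> homeo M) : ucontinuous_isotopy Phi ->
  forall e : R, 0 < e -> exists2 d : R, 0 < d & forall s u : R,
    s \in `[0, 1] -> u \in `[0, 1] -> `|s - u| < d ->
    close e (fun t => Phi (s * t)) (fun t => Phi (u * t)).
Proof.
move=> [uF uFi] e e0; have [d d0 Hd] := uF e e0; have [r r0 Hr] := uFi e e0.
exists (Num.min d r) => [|s u s01 u01]; first by rewrite lt_min d0.
rewrite lt_min => /andP[sd sr] t x t01.
have st : `|s * t - u * t| <= `|s - u|.
  rewrite -mulrBl normrM ler_piMr//.
  by move: t01; rewrite in_itv /= => /andP[? ?]; rewrite ger0_norm.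
split.
- have := Hd (s * t) (u * t) x x; rewrite !ballEmdist /= mdistxx; apply => //;
    try exact: mulr_itv01; exact: le_lt_trans st sd.
- have := Hr (s * t) (u * t) x x; rewrite !ballEmdist /= mdistxx; apply => //;
    try exact: mulr_itv01; exact: le_lt_trans st sr.
Qed.

End isotopy_distance.

(** * Continuous dependence of Hamiltonians on the system *)

Section hamiltonian_distance.
Context {R : realType} {M : pointedMetricType R}.
Context (mu : {measure set (g_sigma_algebraType (@open M)) -> \bar R}).
Hypothesis cM : compact [set: M].

Lemma cvge0P (u : nat -> \bar R) : (forall i, 0 <= u i)%E ->
  u @ \oo --> 0%E <-> forall e : R, 0 < e -> \forall i \near \oo, (u i < e%:E)%E.
Proof.
move=> u0; split => H.
  move=> e e0; apply: (H [set y | (y < e%:E)%E]).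
  have : \forall r \near (0 : R), r < e by exact: lt_nbhsl.
  by apply: filterS => r; rewrite /= lte_fin.
move=> A; rewrite /nbhs /= => /nbhs_ballP[e /= e0 He].
apply: filterS (H e e0) => i /=; have := u0 i.
case: (u i) => [r| |]//=; rewrite lee_fin lte_fin => r0 re.
by apply: He; rewrite /ball /= sub0r normrN ger0_norm.
Qed.

Lemma hnorm1_lt_ext (F G : R -> M -> R) (a : R) : (forall t x, F t x = G t x) ->
  (hnorm1 mu F < a%:E)%E -> (hnorm1 mu G < a%:E)%E.
Proof. by move=> FG; have -> : F = G by apply/funext => t; apply/funext. Qed.

Lemma hnorm1_ltD (F G : R -> M -> R) (a b : R) : strongly_measurable F ->
  strongly_measurable G ->
  (hnorm1 mu F < a%:E)%E -> (hnorm1 mu G < b%:E)%E ->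
  (hnorm1 mu (fun t x => F t x + G t x)%R < (a + b)%:E)%E.
Proof.
move=> sF sG Fa Gb.
have sD : strongly_measurable (fun t x => F t x + G t x).
  have := strongly_measurable_lin 1 1 sF sG; congr strongly_measurable.
  by apply/funext => t; apply/funext => x; rewrite !mul1r.
have := @hnorm1_triangle R M mu cM 1 1 _ F G ler01 ler01 sD sF sG.
rewrite !mul1e EFinD => H; apply: le_lt_trans (lteD Fa Gb); apply: H => t t01.
by rewrite !mul1r; apply: hnormD => //; [exact: sF.1|exact: sG.1].
Qed.

Lemma strongly_measurableN (H : R -> M -> R) : strongly_measurable H ->
  strongly_measurable (fun t x => - H t x).
Proof.
move=> sH; have := strongly_measurable_lin (-1) 0 sH sH; congr strongly_measurable.
by apply/funext => t; apply/funext => x; rewrite mulN1r mul0r addr0.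
Qed.

Lemma hnorm1N_le (H : R -> M -> R) : strongly_measurable H ->
  (hnorm1 mu (fun t x => - H t x)%R <= hnorm1 mu H)%E.
Proof.
move=> sH.
have := @hnorm1_triangle R M mu cM 1 0 _ H H ler01 (lexx 0) (strongly_measurableN sH)
  sH sH.
rewrite mul1e mul0e adde0; apply => t t01; rewrite mul1r mul0r addr0.
have := @hnormZ R M mu cM (-1) (H t) (sH.1 t t01); rewrite normrN1 mul1r.
by congr (hnorm mu _ <= _); apply/funext => x; rewrite mulN1r.
Qed.

Lemma hnorm1_ltB (F G : R -> M -> R) (a b : R) : strongly_measurable F ->
  strongly_measurable G ->
  (hnorm1 mu F < a%:E)%E -> (hnorm1 mu G < b%:E)%E ->
  (hnorm1 mu (sub_ham F G) < (a + b)%:E)%E.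
Proof.
move=> sF sG Fa Gb.
exact: (hnorm1_ltD sF (strongly_measurableN sG) Fa (le_lt_trans (hnorm1N_le sG) Gb)).
Qed.

Lemma strongly_measurableB (F G : R -> M -> R) : strongly_measurable F ->
  strongly_measurable G -> strongly_measurable (sub_ham F G).
Proof.
move=> sF sG; have := strongly_measurable_lin 1 (-1) sF sG; congr strongly_measurable.
by apply/funext => t; apply/funext => x; rewrite mul1r mulN1r.
Qed.

Lemma hnorm1_lt_comp (H : R -> M -> R) (phi : R -> M -> M) (a : R) :
  strongly_measurable H -> ucontinuous_family phi -> (hnorm1 mu H < a%:E)%E ->
  (hnorm1 mu (fun t x => H t (phi t x)) < (2 * a)%:E)%E.
Proof.
move=> sH uphi Ha; apply: le_lt_trans (hnorm1_comp mu cM sH uphi) _.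
by rewrite EFinM lte_pmul2l// lte_fin.
Qed.

(** What a topological Hamiltonian retains of continuity in time: [K] carries the modulus that [D]
    lacks. *)
Definition approximable (D : R -> M -> R) := strongly_measurable D /\
  forall e : R, 0 < e -> exists2 K : R -> M -> R, ucontinuous_family K &
    (hnorm1 mu (sub_ham D K) < e%:E)%E.

Lemma ucontinuousB (F G : R -> M -> R) : ucontinuous_family F ->
  ucontinuous_family G -> ucontinuous_family (sub_ham F G).
Proof.
move=> uF uG e e0; have e20 : 0 < e / 2 by rewrite divr_gt0.
have [d d0 Hd] := uF _ e20; have [r r0 Hr] := uG _ e20.
exists (Num.min d r) => [|t s x y t01 s01]; first by rewrite lt_min d0.
rewrite lt_min => /andP[td tr] xy.
have xd : ball x d y by apply: le_ball xy; rewrite ge_min lexx.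
have xr : ball x r y by apply: le_ball xy; rewrite ge_min lexx orbT.
have := Hd t s x y t01 s01 td xd; have := Hr t s x y t01 s01 tr xr.
rewrite /ball /= /sub_ham !ltr_norml => /andP[? ?] /andP[? ?].
by apply/andP; split; lra.
Qed.

Lemma approximableB (F G : R -> M -> R) :
  approximable F -> approximable G -> approximable (sub_ham F G).
Proof.
move=> [sF aF] [sG aG]; split; first exact: strongly_measurableB.
move=> e e0; have e20 : 0 < e / 2 by rewrite divr_gt0.
have [K uK FK] := aF _ e20; have [L uL GL] := aG _ e20.
exists (sub_ham K L); first exact: ucontinuousB.
have sK := strongly_measurable_ucontinuous uK;
  have sL := strongly_measurable_ucontinuous uL.
have := hnorm1_ltB (strongly_measurableB sF sK) (strongly_measurableB sG sL) FK GL;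
  rewrite -splitr.
by apply: hnorm1_lt_ext => t x; rewrite /sub_ham; ring.
Qed.

(** The difference splits into [D - K] at [phi], minus [D - K] at [psi], plus the variation of [K]
    between the two. *)
Lemma approximable_comp_close (D : R -> M -> R) : approximable D ->
  forall e : R, 0 < e -> exists2 d : R, 0 < d & forall phi psi : R -> M -> M,
    ucontinuous_family phi -> ucontinuous_family psi ->
    (forall t x, t \in `[0, 1] -> mdist (phi t x) (psi t x) < d) ->
    (hnorm1 mu (fun t x => D t (phi t x) - D t (psi t x))%R < e%:E)%E.
Proof.
(* The three terms stay below [2 * (e / 8)], [2 * (e / 8)] and [4 * (e / 8)]: a factor 2 for
   composition, and 3 rounded up to 4 for the sup norm, which makes the last bound strict. *)
move=> [sD aD] e e0; have e80 : 0 < e / 8 by rewrite divr_gt0.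
have [K uK DK] := aD _ e80; have [d d0 Hd] := uK _ e80.
have sK := strongly_measurable_ucontinuous uK.
exists d => // phi psi uphi upsi cl.
have sDK := strongly_measurableB sD sK.
have h1 := hnorm1_lt_comp sDK uphi DK; have h2 := hnorm1_lt_comp sDK upsi DK.
have sc1 := strongly_measurable_comp cM sDK uphi;
  have sc2 := strongly_measurable_comp cM sDK upsi.
have sk : strongly_measurable (fun t x => K t (phi t x) - K t (psi t x)).
  exact: strongly_measurableB (strongly_measurable_comp cM sK uphi)
    (strongly_measurable_comp cM sK upsi).
have h3 : (hnorm1 mu (fun t x => K t (phi t x) - K t (psi t x))%R < (4 * (e / 8))%:E)%E.
  apply: (@le_lt_trans _ _ (3 * (e / 8))%:E); last by rewrite lte_fin ltr_pM2r// ltr_nat.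
  apply: hnorm1_le => // t x t01.
  have := Hd t t (phi t x) (psi t x) t01 t01; rewrite subrr normr0 => /(_ d0).
  by rewrite ballEmdist /= => /(_ (cl t x t01)) /ltW.
have := hnorm1_ltD (strongly_measurableB sc1 sc2) sk (hnorm1_ltB sc1 sc2 h1 h2) h3.
rewrite (_ : (fun t x => _) = (fun t x => D t (phi t x) - D t (psi t x))); last first.
  by apply/funext => t; apply/funext => x; rewrite /sub_ham; ring.
by move=> /lt_le_trans; apply; rewrite lee_fin; lra.
Qed.

Definition quotient_ham (Phi : R -> homeo M) (H F : R -> M -> R) : R -> M -> R :=
  fun t x => F t (Phi t x) - H t (Phi t x).

Lemma strongly_measurable_quotient (Phi : R -> homeo M) (H F : R -> M -> R) :
  ucontinuous_isotopy Phi -> strongly_measurable H -> strongly_measurable F ->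
    strongly_measurable (quotient_ham Phi H F).
Proof.
by move=> [uF _] sH sF;
  exact: strongly_measurableB (strongly_measurable_comp cM sF uF)
    (strongly_measurable_comp cM sH uF).
Qed.

(** With [D = F - H], the difference is [D] at [Phi] minus [D] at [Phi'], plus [(F - F') - (H - H')]
    at [Phi']. Only the fixed [D] is approximated; the varying Hamiltonians enter through their
    distance to the fixed ones, which composition at most doubles. *)
Lemma quotient_ham_close (Phi : R -> homeo M) (H F : R -> M -> R) :
  ucontinuous_isotopy Phi -> approximable H -> approximable F ->
  forall e : R, 0 < e -> exists2 d : R, 0 < d & forall Phi' H' F',
    ucontinuous_isotopy Phi' -> strongly_measurable H' -> strongly_measurable F' ->
      close d Phi' Phi ->
    (hnorm1 mu (sub_ham H H') < d%:E)%E -> (hnorm1 mu (sub_ham F F') < d%:E)%E ->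
    (hnorm1 mu (sub_ham (quotient_ham Phi H F) (quotient_ham Phi' H' F')) < e%:E)%E.
Proof.
move=> [uF _] aH aF e e0; have [sH _] := aH; have [sF _] := aF.
(* One share for the change of isotopy, and [2 * (e / 5 + e / 5)] for the change of the two
   Hamiltonians. *)
have e50 : 0 < e / 5 by rewrite divr_gt0.
have [d d0 Hd] := approximable_comp_close (approximableB aF aH) e50.
exists (Num.min d (e / 5)); first by rewrite lt_min d0.
move=> Phi' H' F' [uF' _] sH' sF' cl HH' FF'.
have le5 : ((Num.min d (e / 5))%:E <= (e / 5)%:E)%E by rewrite lee_fin ge_min lexx orbT.
have {}HH' := lt_le_trans HH' le5; have {}FF' := lt_le_trans FF' le5.
have h1 : (hnorm1 mu (fun t x => sub_ham F H t (Phi t x) - sub_ham F H t (Phi' t x))%R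
    < (e / 5)%:E)%E.
  apply: Hd => // t x t01; have [+ _] := closeC cl x t01.
  by rewrite lt_min => /andP[].
have sFF := strongly_measurableB sF sF'; have sHH := strongly_measurableB sH sH'.
have h2 := hnorm1_lt_comp (strongly_measurableB sFF sHH) uF' (hnorm1_ltB sFF sHH FF' HH').
have sFH := strongly_measurableB sF sH.
have := hnorm1_ltD (strongly_measurableB (strongly_measurable_comp cM sFH uF)
  (strongly_measurable_comp cM sFH uF'))
  (strongly_measurable_comp cM (strongly_measurableB sFF sHH) uF') h1 h2.
rewrite (_ : (fun t x => _) = sub_ham (quotient_ham Phi H F) (quotient_ham Phi' H' F'));
  last first.
  by apply/funext => t; apply/funext => x; rewrite /sub_ham /quotient_ham; ring.
by move=> /lt_le_trans; apply; rewrite lee_fin; lra.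
Qed.

Definition reparam_ham (s : R) (H : R -> M -> R) : R -> M -> R :=
  fun t x => s * H (s * t) x.

Lemma hnorm1_lt_reparam (s a : R) (H : R -> M -> R) : s \in `[0, 1] ->
  strongly_measurable H ->
  (hnorm1 mu H < a%:E)%E -> (hnorm1 mu (reparam_ham s H) < a%:E)%E.
Proof. by move=> s01 sH; apply: le_lt_trans; exact: hnorm1_reparam. Qed.

Lemma ucontinuous_bounded (K : R -> M -> R) : ucontinuous_family K ->
  exists B : R, forall t x, t \in `[0, 1] -> `|K t x| <= B.
Proof.
move=> /ucontinuous_jointly_continuous /jointly_continuousP cK.
have cC : compact ((`[0, 1]%classic : set R) `*` [set: M]).
  by apply: compact_setX => //; exact: segment_compact.
have /compact_bounded[B [_ HB]] := continuous_compact cK cC.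
exists (B + 1) => t x t01; apply: (HB (B + 1)); first by rewrite ltrDl.
by exists (t, x).
Qed.

(** Changing speed does not increase [hnorm1], so [H] may be replaced by [K] at both speeds. For
    [K], the splitting [s * (K (s * t) x - K (u * t) x) + (s - u) * K (u * t) x] uses its modulus
    and its bound. *)
Lemma reparam_ham_close (H : R -> M -> R) : approximable H ->
  forall e : R, 0 < e -> exists2 d : R, 0 < d & forall s u : R,
    s \in `[0, 1] -> u \in `[0, 1] -> `|s - u| < d ->
    (hnorm1 mu (sub_ham (reparam_ham s H) (reparam_ham u H)) < e%:E)%E.
Proof.
(* Each replacement costs [e / 10]. Each term for [K] is at most [e / 10], so [K] costs at most
   [3 * (e / 5)], strictly less than the remaining [4 * (e / 5)]. *)
move=> [sH aH] e e0; have e10 : 0 < e / 10 by rewrite divr_gt0.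
have [K uK HK] := aH _ e10; have [d d0 Hd] := uK _ e10.
have [B HB] := ucontinuous_bounded uK.
have B0 : 0 <= B.
  by apply: le_trans (HB 0 point _) => //; rewrite in_itv /= lexx ler01.
have B1 : 0 < B + 1 by rewrite ltr_wpDl.
have sK := strongly_measurable_ucontinuous uK; have sHK := strongly_measurableB sH sK.
exists (Num.min d (e / 10 / (B + 1))); first by rewrite lt_min d0 divr_gt0.
move=> s u s01 u01; rewrite lt_min => /andP[sd sB].
have hs := hnorm1_lt_reparam s01 sHK HK; have hu := hnorm1_lt_reparam u01 sHK HK.
have ss := strongly_measurable_reparam s01 sHK;
  have su := strongly_measurable_reparam u01 sHK.
have sk := strongly_measurableB (strongly_measurable_reparam s01 sK)
  (strongly_measurable_reparam u01 sK).
have hk : (hnorm1 mu (sub_ham (reparam_ham s K) (reparam_ham u K)) <= (3 * (e / 5))%:E)%E.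
  apply: hnorm1_le => // t x t01.
  have st : `|s * t - u * t| <= `|s - u|.
    rewrite -mulrBl normrM ler_piMr//.
    by move: t01; rewrite in_itv /= => /andP[? ?]; rewrite ger0_norm.
  have k1 : `|K (s * t) x - K (u * t) x| < e / 10.
    apply: Hd; [exact: mulr_itv01|exact: mulr_itv01|exact: le_lt_trans st sd|exact:
      ballxx].
  have k2 := HB (u * t) x (mulr_itv01 u01 t01).
  rewrite /sub_ham /reparam_ham.
  rewrite (_ : _ - _ = s * (K (s * t) x - K (u * t) x) + (s - u) * K (u * t) x);
    last by ring.
  rewrite (le_trans (ler_normD _ _))// !normrM.
  have s1 : `|s| <= 1 by move: s01; rewrite in_itv /= => /andP[? ?]; rewrite ger0_norm.
  have a1 : `|s| * `|K (s * t) x - K (u * t) x| <= e / 10.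
    by rewrite (le_trans _ (ltW k1))// ler_piMl.
  have a2 : `|s - u| * `|K (u * t) x| <= e / 10.
    apply: (@le_trans _ _ (e / 10 / (B + 1) * (B + 1))).
      by apply: ler_pM => //; [exact: ltW|rewrite (le_trans k2)// lerDl].
    by rewrite divfK// gt_eqF.
  lra.
have {}hk : (hnorm1 mu (sub_ham (reparam_ham s K) (reparam_ham u K)) < (4 * (e /
  5))%:E)%E.
  by apply: le_lt_trans hk _; rewrite lte_fin; lra.
have := hnorm1_ltD (strongly_measurableB ss su) sk (hnorm1_ltB ss su hs hu) hk.
rewrite (_ : (fun t x => _) = sub_ham (reparam_ham s H) (reparam_ham u H)); last first.
  by apply/funext => t; apply/funext => x; rewrite /sub_ham /reparam_ham; ring.
by move=> /lt_le_trans; apply; rewrite lee_fin; lra.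
Qed.

End hamiltonian_distance.

Lemma homeo_ext (M : topologicalType) (f g : homeo M) :
  (forall x, f x = g x) -> f = g.
Proof.
move=> fg; have fgi x : hinv f x = hinv g x.
  by rewrite -[in LHS](hinvK g x) -fg hfunK.
case: f g fg fgi => [f fi cf cfi fK fiK] [g gi cg cgi gK giK] /= fg fgi.
have E1 : f = g by apply/funext.
have E2 : fi = gi by apply/funext.
by subst g gi; congr Homeo; exact: Prop_irrelevance.
Qed.

(** * The group of topological systems and its continuity *)

Section systems.
Context {R : realType} {M : pointedMetricType R} {n : nat}.
Context (S : smooth_structure R M n.*2.+1) (alpha : form_coefs R M n.*2.+1).
Context (mu : {measure set (g_sigma_algebraType (@open M)) -> \bar R}).
Hypothesis cM : compact [set: M].
Hypothesis alpha_form : is_one_form S alpha.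

Lemma smooth_scds_ucontinuous (Phi : R -> homeo M) (H : R -> M -> R) :
  smooth_scds S alpha Phi H -> ucontinuous_isotopy Phi /\ ucontinuous_family H.
Proof.
move=> sPH; have [[[sF sFi _] _] _] := sPH; split.
  by split; apply: jointly_continuous_ucontinuous => //; apply/continuous_familyP;
    [exact: sF.1|exact: sFi.1].
apply: jointly_continuous_ucontinuous => //.
exact: jointly_continuous_hamiltonian sPH.
Qed.

(** Working form of [is_tscds], with [e]-approximations in place of sequences. [continuous_family]
    concerns [Phi] alone; uniform continuity of the inverses comes from the approximants, because
    [dbar] compares inverses too. *)
Lemma is_tscdsP (Phi : R -> homeo M) (H : R -> M -> R) :
  is_tscds S alpha mu Phi H <->
  [/\ ucontinuous_isotopy Phi, strongly_measurable H &
      forall e : R, 0 < e -> exists (Phi' : R -> homeo M) (H' : R -> M -> R),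
        [/\ smooth_scds S alpha Phi' H', close e Phi' Phi &
            (hnorm1 mu (sub_ham H H') < e%:E)%E]].
Proof.
split.
- move=> [_ /(L1C0P mu)[sH _] [Phi_ [H_ [sPH cPhi cH]]]].
  have /(cvg_dbar_isoP cM) clP := cPhi.
  have sD i : strongly_measurable (sub_ham H (H_ i)).
    by apply: strongly_measurableB => //; apply: strongly_measurable_ucontinuous;
      exact: (smooth_scds_ucontinuous (sPH i)).2.
  have /cvge0P clH : (fun i => hnorm1 mu (sub_ham H (H_ i))) @ \oo --> 0%E by exact: cH.
  have {}clH := clH (fun i => hnorm1_ge0 mu cM (sD i)).
  have app (e : R) : 0 < e -> exists i, close e (Phi_ i) Phi /\
      (hnorm1 mu (sub_ham H (H_ i)) < e%:E)%E.
    move=> e0; exact: (filter_ex (filterI (clP e e0) (clH e e0))).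
  split => //.
    split; apply: ucontinuous_limit => e e0; have [i [cl _]] := app e e0;
      have [[uF uFi] _] := smooth_scds_ucontinuous (sPH i).
      by exists (fun t => Phi_ i t) => // t x t01; case: (cl t x t01).
    by exists (fun t => hinv (Phi_ i t)) => // t x t01; case: (cl t x t01).
  by move=> e e0; have [i [cl clh]] := app e e0; exists (Phi_ i), (H_ i).
- move=> [uF sH app]; split.
  + by apply/continuous_familyP; apply: ucontinuous_jointly_continuous; exact: uF.1.
  + apply/(L1C0P mu); split => //.
    (* A single approximation at distance 1 gives integrability, since its smooth Hamiltonian is
       bounded. *)
    have [Phi' [H' [sPH _ h]]] := app 1 ltr01.
    have [_ uH'] := smooth_scds_ucontinuous sPH.
    have sH' := strongly_measurable_ucontinuous uH'.
    have [B HB] := ucontinuous_bounded cM uH'.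
    have h' : (hnorm1 mu H' < (3 * B + 1)%:E)%E.
      by apply: le_lt_trans (hnorm1_le mu cM sH' HB) _; rewrite lte_fin ltrDl.
    have := hnorm1_ltD cM (strongly_measurableB sH sH') sH' h h'.
    rewrite (_ : (fun t x => _) = H); last first.
      by apply/funext => t; apply/funext => x; rewrite /sub_ham subrK.
    by move=> /lt_trans; apply; rewrite ltry.
  + have {}app i : exists PH : (R -> homeo M) * (R -> M -> R),
        [/\ smooth_scds S alpha PH.1 PH.2, close i.+1%:R^-1 PH.1 Phi &
          (hnorm1 mu (sub_ham H PH.2) < (i.+1%:R^-1)%:E)%E].
      have [|Phi' [H' [a b c]]] := app (i.+1%:R^-1); first by rewrite invr_gt0.
      by exists (Phi', H').
    have [PH HPH] := choice app.
    have small (e : R) : 0 < e -> \forall i \near \oo, i.+1%:R^-1 < e.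
      by move=> e0; exact: (near_infty_natSinv_lt (PosNum e0)).
    exists (fun i => (PH i).1), (fun i => (PH i).2); split.
    * by move=> i; case: (HPH i).
    * apply/(cvg_dbar_isoP cM) => e e0; apply: filterS (small e e0) => i ie t x t01.
      have [_ cl _] := HPH i; have [a b] := cl t x t01.
      by split; apply: lt_trans ie.
    * apply/cvge0P.
        move=> i; apply: hnorm1_ge0 => //; apply: strongly_measurableB => //;
          apply: strongly_measurable_ucontinuous.
        by have [sPH _ _] := HPH i; exact: (smooth_scds_ucontinuous sPH).2.
      move=> e e0; apply: filterS (small e e0) => i ie.
      by have [_ _ h] := HPH i; apply: lt_trans h _; rewrite lte_fin.
Qed.

Lemma is_tscds_approximable Phi H : is_tscds S alpha mu Phi H -> approximable mu H.
Proof.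
move=> /is_tscdsP[_ sH app]; split => // e e0.
have [Phi' [H' [sPH _ h]]] := app e e0.
by exists H' => //; exact: (smooth_scds_ucontinuous sPH).2.
Qed.

Lemma is_tscds_time0 Phi H x : is_tscds S alpha mu Phi H -> Phi 0 x = x.
Proof.
move=> /is_tscdsP[_ _ app]; apply/eqP; rewrite eq_sym -[_ == _]negbK.
rewrite -(@mdist_gt0 R M); apply/negP => h.
have [Phi' [H' [[[[_ _ P0] _] _] cl _]]] := app _ h.
have [] := cl 0 x; first by rewrite in_itv /= lexx ler01.
by rewrite P0 ltxx.
Qed.

(** Quotients of smooth approximants are smooth systems; [close_quotient] and [quotient_ham_close],
    both based at the limit systems, tell how good the approximants have to be. *)
Lemma is_tscds_quotient Phi H Psi F :
  is_tscds S alpha mu Phi H -> is_tscds S alpha mu Psi F ->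
  is_tscds S alpha mu (quotient Phi Psi) (quotient_ham Phi H F).
Proof.
move=> tP tQ; have aH := is_tscds_approximable tP; have aF := is_tscds_approximable tQ.
have /is_tscdsP[uP sH appP] := tP; have /is_tscdsP[uQ sF appQ] := tQ.
apply/is_tscdsP; split.
- exact: ucontinuous_quotient.
- exact: strongly_measurable_quotient.
- move=> e e0.
  have [d d0 Hd] := close_quotient uP uQ e0.
  have [r r0 Hr] := quotient_ham_close cM uP aH aF e0.
  have m0 : 0 < Num.min d r by rewrite lt_min d0.
  have [Phi' [H' [sP' clP hP]]] := appP _ m0.
  have [Psi' [F' [sQ' clQ hQ]]] := appQ _ m0.
  have cld (Phi1 Phi2 : R -> homeo M) : close (Num.min d r) Phi1 Phi2 ->
    close d Phi1 Phi2 /\ close r Phi1 Phi2.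
    by move=> cl; split => t x t01; have [] := cl t x t01;
      rewrite !lt_min => /andP[? ?] /andP[? ?].
  have mr : ((Num.min d r)%:E <= r%:E)%E by rewrite lee_fin ge_min lexx orbT.
  have [uP' uH'] := smooth_scds_ucontinuous sP'.
  have [uQ' uF'] := smooth_scds_ucontinuous sQ'.
  exists (quotient Phi' Psi'), (quotient_ham Phi' H' F'); split.
  + exact: smooth_scds_quotient.
  + by apply: Hd; [exact: (cld _ _ clP).1|exact: (cld _ _ clQ).1].
  + apply: Hr => //; try exact: strongly_measurable_ucontinuous.
    * exact: (cld _ _ clP).2.
    * exact: lt_le_trans hP mr.
    * exact: lt_le_trans hQ mr.
Qed.

Lemma close_reparam_iso e (Phi Psi : R -> homeo M) s : s \in `[0, 1] ->
  close e Phi Psi -> close e (fun t => Phi (s * t)) (fun t => Psi (s * t)).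
Proof. by move=> s01 cl t x t01; apply: cl; exact: mulr_itv01. Qed.

Lemma is_tscds_reparam Phi H s : s \in `[0, 1] -> is_tscds S alpha mu Phi H ->
  is_tscds S alpha mu (fun t => Phi (s * t)) (reparam_ham s H).
Proof.
move=> s01 /is_tscdsP[uP sH app]; apply/is_tscdsP; split.
- by split; [exact: (ucontinuous_reparam s01 uP.1)|exact: (ucontinuous_reparam s01 uP.2)].
- exact: strongly_measurable_reparam.
- move=> e e0; have [Phi' [H' [sPH cl h]]] := app e e0.
  exists (fun t => Phi' (s * t)), (reparam_ham s H'); split.
  + exact: smooth_scds_reparam.
  + exact: close_reparam_iso.
  + have sH' := strongly_measurable_ucontinuous (smooth_scds_ucontinuous sPH).2.
    have := hnorm1_lt_reparam cM s01 (strongly_measurableB sH sH') h.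
    by apply: hnorm1_lt_ext => t x; rewrite /sub_ham /reparam_ham mulrBr.
Qed.

Local Notation T := (tscds S alpha mu).

(** The group identities below hold at every real [t], not just on [[0, 1]] or almost everywhere, so
    systems can be compared by plain equality. *)
Lemma tscds_ext (p q : T) : (forall t x, iso p t x = iso q t x) ->
  (forall t x, ham p t x = ham q t x) -> p = q.
Proof.
case: p q => [Phi H pP] [Psi F qP] /= e1 e2.
have E1 : Phi = Psi by apply/funext => t; exact: homeo_ext.
have E2 : H = F by apply/funext => t; apply/funext.
by subst Psi F; congr Tscds; exact: Prop_irrelevance.
Qed.

Definition system_ldiv (p q : T) : T := Tscds (is_tscds_quotient (tscdsP p) (tscdsP q)).

(** Gives a meaning to every real speed, so that paths of systems are continuous on all of [R];
    being 1-Lipschitz, it preserves moduli of continuity. *)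
Definition clamp (s : R) : R := Num.max 0 (Num.min 1 s).

Lemma clamp_itv s : clamp s \in `[0, 1].
Proof. by rewrite in_itv /= le_max lexx /= ge_max ler01 ge_min lexx. Qed.

Lemma clamp_id s : s \in `[0, 1] -> clamp s = s.
Proof.
by rewrite in_itv /= => /andP[s0 s1]; rewrite /clamp (min_idPr s1) (max_idPr s0).
Qed.

Lemma clamp_lip s u : `|clamp s - clamp u| <= `|s - u|.
Proof.
have h1 := ler_norm (s - u); have h2 := ler_norm (u - s); rewrite distrC in h2.
rewrite /clamp; case: (leP 1 s) => a1; case: (leP 1 u) => a2; rewrite ?(max_idPr ler01);
  case: (leP 0 s) => a3; case: (leP 0 u) => a4; rewrite ler_norml; apply/andP; split; lra.
Qed.

Definition system_reparam (s : R) (p : T) : T :=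
  Tscds (is_tscds_reparam (clamp_itv s) (tscdsP p)).

Lemma iso0 (p : T) x : iso p 0 x = x.
Proof. exact: is_tscds_time0 (tscdsP p). Qed.

Lemma hinv_iso0 (p : T) x : hinv (iso p 0) x = x.
Proof. by rewrite -[in LHS](iso0 p x) hfunK. Qed.

(** The identity isotopy with Hamiltonian 0; by [system_reparam0] all choices of [p] give the same
    system. *)
Definition system_one (p : T) : T := system_reparam 0 p.

Lemma clamp0 : clamp 0 = 0.
Proof. by rewrite clamp_id// in_itv /= lexx ler01. Qed.

Lemma clamp1 : clamp 1 = 1.
Proof. by rewrite clamp_id// in_itv /= lexx ler01. Qed.

Lemma system_one_iso p t x : iso (system_one p) t x = x.
Proof. by rewrite /= clamp0 mul0r iso0. Qed.

Lemma system_one_hinv p t x : hinv (iso (system_one p) t) x = x.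
Proof. by rewrite /= clamp0 mul0r hinv_iso0. Qed.

Lemma system_one_ham p t x : ham (system_one p) t x = 0.
Proof. by rewrite /= /reparam_ham clamp0 mul0r. Qed.

(** [system_ldiv p (system_one p)] is the inverse of [p], and dividing [q] by it on the left gives
    the product, which thereby inherits membership and continuity from left division. *)
Definition system_mul (p q : T) : T := system_ldiv (system_ldiv p (system_one p)) q.

Lemma system_mul_iso p q t x : iso (system_mul p q) t x = iso p t (iso q t x).
Proof. exact: system_one_hinv. Qed.

Lemma system_mul_ham p q t x :
  ham (system_mul p q) t x = ham p t x + ham q t (hinv (iso p t) x).
Proof.
rewrite /= /quotient_ham /=.
have := system_one_ham p t; rewrite /= => ->; have := system_one_iso p t; rewrite /= =>
  ->.
by rewrite hinvK sub0r opprK addrC.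
Qed.

Lemma system_mul1 p : system_mul p (system_one p) = p.
Proof.
apply: tscds_ext => t x; first by rewrite system_mul_iso system_one_iso.
by rewrite system_mul_ham system_one_ham addr0.
Qed.

Lemma system_mulKV p q : system_mul p (system_ldiv p q) = q.
Proof.
apply: tscds_ext => t x; first by rewrite system_mul_iso; exact: hinvK.
by rewrite system_mul_ham /= /quotient_ham hinvK addrC subrK.
Qed.

Lemma system_ldivv p : system_ldiv p p = system_one p.
Proof.
apply: tscds_ext => t x; first by rewrite system_one_iso; exact: hfunK.
by rewrite system_one_ham /= /quotient_ham subrr.
Qed.

Lemma system_reparam1 p : system_reparam 1 p = p.
Proof.
by apply: tscds_ext => t x; rewrite /= ?/reparam_ham clamp1 ?mul1r.
Qed.

Lemma system_reparam0 p q : system_reparam 0 p = system_one q.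
Proof.
apply: tscds_ext => t x; first by rewrite (system_one_iso p) system_one_iso.
by rewrite (system_one_ham p) system_one_ham.
Qed.

Lemma system_reparam_one s p : system_reparam s (system_one p) = system_one p.
Proof.
apply: tscds_ext => t x; first by rewrite [LHS]system_one_iso system_one_iso.
by rewrite system_one_ham /= /reparam_ham clamp0 mul0r mulr0.
Qed.

Definition system_path (p q : T) (s : R) : T := system_mul p (system_reparam s
  (system_ldiv p q)).

Lemma system_path0 p q : system_path p q 0 = p.
Proof. by rewrite /system_path (system_reparam0 _ p) system_mul1. Qed.

Lemma system_path1 p q : system_path p q 1 = q.
Proof. by rewrite /system_path system_reparam1 system_mulKV. Qed.

Lemma system_path_time1 p q s : s \in `[0, 1] ->
  iso (system_path p q s) 1 = comp_homeo (iso p 1) (iso (system_ldiv p q) s).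
Proof.
move=> s01; apply: homeo_ext => x.
by rewrite system_mul_iso [iso (system_reparam _ _)]/= clamp_id// mulr1.
Qed.

Lemma ucontinuous_iso (p : T) : ucontinuous_isotopy (iso p).
Proof. by have /is_tscdsP[] := tscdsP p. Qed.

Lemma strongly_measurable_ham (p : T) : strongly_measurable (ham p).
Proof. by have /is_tscdsP[] := tscdsP p. Qed.

Lemma approximable_ham (p : T) : approximable mu (ham p).
Proof. exact: is_tscds_approximable (tscdsP p). Qed.

Lemma d_alpha_ltE (p q : T) e : (d_alpha p q < e%:E)%E ->
  close e (iso p) (iso q) /\ (hnorm1 mu (sub_ham (ham p) (ham q)) < e%:E)%E.
Proof.
rewrite /d_alpha => h.
have h0 : (0 <= hnorm1 mu (sub_ham (ham p) (ham q)))%E.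
  by apply: hnorm1_ge0 => //; apply: strongly_measurableB; exact: strongly_measurable_ham.
have d0 : (0 <= (dbar_iso (iso p) (iso q))%:E)%E by rewrite lee_fin dbar_iso_ge0.
split; last by apply: le_lt_trans h; rewrite leeDr.
apply: dbar_iso_close => //; rewrite -lte_fin; apply: le_lt_trans h.
by rewrite leeDl.
Qed.

(** [close (e / 4)] bounds [dbar_iso] by [e / 2], which together with [e / 4] for the Hamiltonians
    stays below [e]. *)
Lemma d_alpha_lt (p q : T) e : 0 < e -> close (e / 4) (iso p) (iso q) ->
  (hnorm1 mu (sub_ham (ham p) (ham q)) < (e / 4)%:E)%E ->
  (d_alpha p q < e%:E)%E.
Proof.
move=> e0 /close_dbar_iso cl h; rewrite /d_alpha.
apply: (@lt_le_trans _ _ ((e / 2)%:E + (e / 4)%:E)%E).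
  by apply: lee_ltD => //; rewrite lee_fin; lra.
by rewrite -EFinD lee_fin; lra.
Qed.

Lemma d_alpha_refl (p : T) e : 0 < e -> (d_alpha p p < e%:E)%E.
Proof.
move=> e0; apply: (d_alpha_lt e0).
  by move=> t x t01; rewrite !mdistxx divr_gt0.
apply: (@le_lt_trans _ _ (3 * 0)%:E); last by rewrite mulr0 lte_fin divr_gt0.
apply: hnorm1_le => //; first by apply: strongly_measurableB;
  exact: strongly_measurable_ham.
by move=> t x _; rewrite /sub_ham subrr normr0.
Qed.

Lemma system_ldiv_continuous (p q : T) e : 0 < e -> exists2 d : R, 0 < d &
  forall p' q' : T, (d_alpha p p' < d%:E)%E -> (d_alpha q q' < d%:E)%E ->
    (d_alpha (system_ldiv p q) (system_ldiv p' q') < e%:E)%E.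
Proof.
move=> e0; have e40 : 0 < e / 4 by rewrite divr_gt0.
have [d d0 Hd] := close_quotient (ucontinuous_iso p) (ucontinuous_iso q) e40.
have [r r0 Hr] := quotient_ham_close cM (ucontinuous_iso p) (approximable_ham p)
  (approximable_ham q) e40.
exists (Num.min d r); first by rewrite lt_min d0.
move=> p' q' pp qq.
have md : ((Num.min d r)%:E <= d%:E)%E by rewrite lee_fin ge_min lexx.
have mr : ((Num.min d r)%:E <= r%:E)%E by rewrite lee_fin ge_min lexx orbT.
have [cpd _] := d_alpha_ltE (lt_le_trans pp md).
have [cpr hpr] := d_alpha_ltE (lt_le_trans pp mr).
have [cqd _] := d_alpha_ltE (lt_le_trans qq md).
have [_ hqr] := d_alpha_ltE (lt_le_trans qq mr).
apply: (d_alpha_lt e0).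
  by apply: closeC; apply: Hd; exact: closeC.
exact: (Hr _ _ _ (ucontinuous_iso p') (strongly_measurable_ham p')
  (strongly_measurable_ham q') (closeC cpr) hpr hqr).
Qed.

Lemma system_reparam_continuous (p : T) e : 0 < e -> exists2 d : R, 0 < d &
  forall s u : R, `|s - u| < d ->
    (d_alpha (system_reparam s p) (system_reparam u p) < e%:E)%E.
Proof.
move=> e0; have e40 : 0 < e / 4 by rewrite divr_gt0.
have [d d0 Hd] := close_reparam (ucontinuous_iso p) e40.
have [r r0 Hr] := reparam_ham_close cM (approximable_ham p) e40.
exists (Num.min d r) => [|s u]; first by rewrite lt_min d0.
move=> /(le_lt_trans (clamp_lip s u)); rewrite lt_min => /andP[h1 h2].
apply: (d_alpha_lt e0).
  exact: (Hd _ _ (clamp_itv s) (clamp_itv u) h1).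
exact: (Hr _ _ (clamp_itv s) (clamp_itv u) h2).
Qed.

(** The bound is uniform in the speed, since running at speed [s] worsens neither [close] nor
    [hnorm1]; the 4 comes from [d_alpha_lt]. *)
Lemma system_reparam_small (p q : T) e s : 0 < e -> (d_alpha p q < (e / 4)%:E)%E ->
  (d_alpha (system_reparam s p) (system_reparam s q) < e%:E)%E.
Proof.
move=> e0 /d_alpha_ltE[cl h]; apply: (d_alpha_lt e0).
  exact: (close_reparam_iso (clamp_itv s) cl).
have := hnorm1_lt_reparam cM (clamp_itv s) (strongly_measurableB
  (strongly_measurable_ham p) (strongly_measurable_ham q)) h.
by apply: hnorm1_lt_ext => t x; rewrite /= /sub_ham /reparam_ham mulrBr.
Qed.

(** The path from [p] to itself is constant: [p \ p = 1], which stays 1 at every speed, and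
    [p * 1 = p]. Continuity of left division at [(p, p)], the bound uniform in the speed and
    continuity of the product at [(p, 1)] combine into a [d] independent of [s]. *)
Lemma system_path_small (p : T) e : 0 < e -> exists2 d : R, 0 < d &
  forall (q : T) s, (d_alpha p q < d%:E)%E -> (d_alpha p (system_path p q s) < e%:E)%E.
Proof.
move=> e0; have [d d0 Hd] := system_ldiv_continuous (system_ldiv p (system_one p))
  (system_one p) e0.
have d40 : 0 < d / 4 by rewrite divr_gt0.
have [r r0 Hr] := system_ldiv_continuous p p d40.
exists r => // q s pq; rewrite -{1}(system_mul1 p).
apply: Hd; first exact: d_alpha_refl.
rewrite -(system_reparam_one s p); apply: system_reparam_small => //.
rewrite -(system_ldivv p); exact: (Hr p q (d_alpha_refl p r0) pq).
Qed.

Lemma system_path_continuous (p q : T) : continuous (system_path p q).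
Proof.
move=> s A; rewrite nbhsE /= => -[U [oU Us] UA].
(* [open] unfolds to [tscds_open], which yields a [d_alpha] ball inside [U]. *)
have [e e0 He] := oU _ Us.
have [d d0 Hd] := system_ldiv_continuous (system_ldiv p (system_one p)) (system_reparam
  s (system_ldiv p q)) e0.
have [r r0 Hr] := system_reparam_continuous (system_ldiv p q) d0.
apply/nbhs_ballP; exists r => // u su; apply: UA; apply: He.
by apply: Hd; [exact: d_alpha_refl|exact: Hr].
Qed.

Local Notation G := (homeo_alpha S alpha mu).

Lemma homeo_alpha_ext (f g : G) : ha_val f = ha_val g -> f = g.
Proof.
case: f g => [f fP] [g gP] /= fg; subst g; congr HomeoAlpha.
exact: Prop_irrelevance.
Qed.

Lemma ev1_surjective (f : G) : exists p : T, ev1 p = f.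
Proof. by have [p pf] := ha_valP f; exists p; exact: homeo_alpha_ext. Qed.

Lemma ev1_continuous : continuous (@ev1 R M n S alpha mu).
Proof. by apply/continuousP => U oU; exact: oU. Qed.

(** The smooth approximants preserve [alpha], so all conformal factors [g_] can be taken equal to
    0. *)
Lemma time1_automorphism (p : T) : is_topological_automorphism S alpha (iso p 1).
Proof.
have [_ _ [Phi_ [H_ [sPH /(cvg_dbar_isoP cM) cl _]]]] := tscdsP p.
have one01 : (1 : R) \in `[0, 1] by rewrite in_itv /= lexx ler01.
exists (fun i => Phi_ i 1), (fun _ _ => 0); split.
- move=> i; have [[[sF sFi _] _] _] := sPH i.
  by split; [exact: (smooth_family_map one01 sF)|exact: (smooth_family_map one01 sFi)].
- move=> i c Sc y cy; exists setT, (cst 0); split => //; first exact: openT.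
  by move=> k; exact: Ck_cst.
- move=> i; have [[_ /(_ 1 one01) pb] _] := sPH i.
  by rewrite (_ : (fun x => expR _) = cst 1)// expR0.
- apply/cvgrPdist_lt => e e0; have e30 : 0 < e / 3 by rewrite divr_gt0.
  apply: filterS (cl _ e30) => i ci.
  rewrite sub0r normrN ger0_norm.
    apply: (@le_lt_trans _ _ (e / 3 + e / 3)); last lra.
    by apply: dbar_le => x; have [a b] := ci 1 x one01; split; exact: ltW.
  by have [+ _] := dbar_ge cM (Phi_ i 1) (iso p 1) point; apply: le_trans;
    exact: mdist_ge0.
- apply/cvg_uniformP => e e0; exists 0 => // i _ x /=; by rewrite /cst subrr normr0.
Qed.

End systems.

(** * Path components of a set *)

Section path_components.
Context {R : realType} {T : topologicalType}.

(** Paths are continuous on all of [R] and stay in [U] at all times, which avoids relative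
    continuity when they are reversed, concatenated or cut. *)
Definition joined (U : set T) (x y : T) := exists g : R -> T,
  [/\ continuous g, forall t, U (g t), g 0 = x & g 1 = y].

Lemma joined_sym U x y : joined U x y -> joined U y x.
Proof.
move=> [g [cg Ug g0 g1]]; exists (fun t => g (1 - t)); split => //.
- move=> t; apply: (@continuous_comp _ _ _ (fun t : R => 1 - t) g); last exact: cg.
  by apply: cvgB; [exact: cvg_cst|exact: cvg_id].
- by rewrite subr0.
- by rewrite subrr.
Qed.

Lemma joined_trans U x y z : joined U x y -> joined U y z -> joined U x z.
Proof.
move=> [g [cg Ug g0 g1]] [h [ch Uh h0 h1]].
pose k (t : R) := if t <= 1 / 2 then g (2 * t) else h (2 * t - 1).
exists k; split.
- have cg' : continuous (fun t : R => g (2 * t)).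
    move=> t; apply: (@continuous_comp _ _ _ (fun t : R => 2 * t) g); last exact: cg.
    exact: mulrl_continuous.
  have ch' : continuous (fun t : R => h (2 * t - 1)).
    move=> t; apply: (@continuous_comp _ _ _ (fun t : R => 2 * t - 1) h); last exact: ch.
    by apply: cvgB; [exact: mulrl_continuous|exact: cvg_cst].
  move=> t A kA; change (\forall s \near t, A (k s)).
  have gA : t <= 1 / 2 -> \forall s \near t, A (g (2 * s)).
    by move=> th; apply: cg'; move: kA; rewrite /k th.
  have hA : 1 / 2 < t -> \forall s \near t, A (h (2 * s - 1)).
    by move=> th; apply: ch'; move: kA; rewrite /k leNgt th.
  have [th|th|th] := ltrgtP t (1 / 2).
  + have n1 : \forall s \near t, s < 1 / 2 by exact: lt_nbhsl.
    by apply: filterS2 (gA (ltW th)) n1 => s /= As s2; rewrite /k ltW.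
  + have n1 : \forall s \near t, 1 / 2 < s by exact: lt_nbhsr.
    by apply: filterS2 (hA th) n1 => s /= As s2; rewrite /k leNgt s2.
  (* At the junction both branches are eventually in [A], so the one selected at a nearby [s] is in
     [A] as well. *)
  + have E : h (2 * t - 1) = g (2 * t).
      by rewrite th mulrA mulr1 divff// subrr h0 g1.
    have {}hA : \forall s \near t, A (h (2 * s - 1)).
      by apply: ch'; move: kA; rewrite E /k th lexx.
    have {}gA : \forall s \near t, A (g (2 * s)) by apply: gA; rewrite th.
    by apply: filterS2 gA hA => s gs hs; rewrite /k; case: ifP.
- by move=> t; rewrite /k; case: ifP.
- by rewrite /k divr_ge0// mulr0.
- by rewrite /k ifF ?mulr1; [rewrite -[2]/(1 + 1) addrK|apply/negbTE; rewrite -ltNge;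
  lra].
Qed.

Lemma joined_point U x (g : R -> T) (t : R) : continuous g ->
  (forall t, U (g t)) -> g 0 = x -> joined U x (g t).
Proof.
move=> cg Ug g0; exists (fun s => g (s * t)); split => //.
- move=> s; apply: (@continuous_comp _ _ _ (fun s : R => s * t) g); last exact: cg.
  exact: mulrr_continuous.
- by rewrite mul0r.
- by rewrite mul1r.
Qed.

(** A path in [U] never leaves the component of its starting point, since each of its points is
    reached by an initial segment. *)
Lemma path_connected_component (U : set T) x : path_connected R (joined U x).
Proof.
move=> y z xy xz; have [g [cg Ug g0 g1]] := joined_trans (joined_sym xy) xz.
exists g; first by split => //; exact: continuous_subspaceT.
by move=> _ [t _ <-]; apply: joined_trans xy _; exact: joined_point.
Qed.

End path_components.

Theorem theorem6p7 (R : realType) (n : nat) (M : pointedMetricType R)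
    (S : smooth_structure R M n.*2.+1)
    (alpha : form_coefs R M n.*2.+1) (g : metric_coefs R M n.*2.+1)
    (mu : {measure set (g_sigma_algebraType (@open M)) -> \bar R}) :
  compact [set: M] -> connected [set: M] ->
  is_contact_form S alpha ->
  is_riemannian_metric S g -> is_riemannian_distance S g ->
  is_contact_volume S alpha mu ->
  [/\ path_connected R [set: homeo_alpha S alpha mu],
      locally_path_connected R (homeo_alpha S alpha mu) &
      forall phi psi : homeo_alpha S alpha mu,
        exists2 gamma : R -> homeo_alpha S alpha mu,
          path_from_to gamma phi psi &
          is_topological_isotopy S alpha mu gamma].
Proof.
move=> cM _ [aF _] _ _ _.
pose path (p q : tscds S alpha mu) (s : R) := ev1 (system_path cM aF p q s).
have path_cont p q : continuous (path p q).
  move=> s; apply: (@continuous_comp _ _ _ (system_path cM aF p q) (@ev1 R M n S alpha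
    mu)).
    exact: system_path_continuous.
  exact: ev1_continuous.
have path0 p q : path p q 0 = ev1 p by rewrite /path system_path0.
have path1 p q : path p q 1 = ev1 q by rewrite /path system_path1.
split.
- move=> phi psi _ _.
  have [[p <-] [q <-]] := (ev1_surjective phi, ev1_surjective psi).
  exists (path p q) => //; split => //; exact: continuous_subspaceT.
- move=> x U oU Ux; exists (@joined R _ U x); split.
  + move=> p [h [ch Uh h0 h1]].
    have Up : U (ev1 p) by rewrite -h1.
    (* Openness of [U] in the quotient topology is openness of its preimage under [ev1], hence a
       [d_alpha] ball around [p], in which the whole path to a nearby [q] is kept. *)
    have [e e0 He] := oU p Up.
    have [d d0 Hd] := system_path_small cM aF p e0.
    exists d => // q pq; apply: (@joined_trans R _ U x (ev1 p)); first by exists h.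
    exists (path p q); split => // t; exact: He (Hd _ _ pq).
  + by exists (fun=> x); split => // t; exact: cvg_cst.
  + by move=> y [h [_ Uh _ <-]].
  + exact: path_connected_component.
- move=> phi psi.
  have [[p <-] [q <-]] := (ev1_surjective phi, ev1_surjective psi).
  exists (path p q); first by split => //; exact: continuous_subspaceT.
  exists (iso p 1), (system_ldiv cM aF p q); split; first exact: time1_automorphism.
  by move=> t t01; exact: system_path_time1.
Qed.
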